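(* In the setting and with the notation of the context, suppose that: (1) $b\in C^{1,4}(\mathbb{R}^d\times\Theta,\mathbb{R}^d)$ (once differentiable in $x$ and four times in $\theta$) and there are constants $c_1,c_2,N>0$ such that for all $x,y\in\mathbb{R}^d$, $\theta\in\Theta$ and integers $0\le i\le 4$, $0\le j\le 1$, $$|b(x,\theta)-b(y,\theta)|\le c_1|x-y|,\qquad |\nabla_x^j\nabla_\theta^i b(x,\theta)|\le c_2(1+|x|^N);$$ (2) $\sigma\in C_b^3(\mathbb{R}^d,\mathbb{R}^d\otimes\mathbb{R}^r)$, i.e. $\sigma$ is three times differentiable and $\sigma$ and all its derivatives up to order three are bounded. Then for every $1/3<\alpha<h$ there exist constants $C_i>0$, $i=1,2,3$, depending on $T,X_0,\alpha$ (for the given coefficients $b,\sigma$; not on $\varepsilon\in(0,1]$ nor on the realization of the path) such that $$\|X^\varepsilon\|_{\alpha,[0,T]}\le C_1\left(1+\|(B,\mathbb{B})\|_{\alpha,[0,T]}^{1/\alpha}\right),$$ $$\|R^{X^\varepsilon}\|_{2\alpha,[0,T]}\le C_2\left(1+\|(B,\mathbb{B})\|_{\alpha,[0,T]}^{2/\alpha}\right),$$ $$\|R^{\sigma(X^\varepsilon)}\|_{2\alpha,[0,T]}\le C_3\left(1+\|(B,\mathbb{B})\|_{\alpha,[0,T]}^{2/\alpha}\right).$$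
   Context: Setting. Let $T>0$, $X_0\in\mathbb{R}^d$, $\varepsilon\in(0,1]$; $\Theta\subset\mathbb{R}^m$ is a bounded open convex set admitting Sobolev's inequalities for the embedding $W^{1,q}(\Theta)\hookrightarrow C(\bar\Theta)$, and $\theta_0\in\Theta$. Let $b:\mathbb{R}^d\times\Theta\to\mathbb{R}^d$ and $\sigma:\mathbb{R}^d\to\mathbb{R}^d\otimes\mathbb{R}^r$ ($d\times r$ matrices). On a probability space $(\Omega,\mathcal F,P)$, $B=(B^{(1)},\dots,B^{(r)})$ has independent components, $B^{(i)}$ being a one-dimensional fractional Brownian motion with Hurst index $H_i\in(1/3,1/2)$. Fix $h<\min_iH_i$; $\alpha$ ranges in $(1/3,h)$. For a path $Y$ write $Y_{s,t}=Y_t-Y_s$. Norms. $\|Y\|_{\alpha,[0,T]}=\sup_{s\ne t\in[0,T]}|Y_{s,t}|/|t-s|^\alpha$ for paths; $\|\mathbb{Y}\|_{2\alpha,[0,T]}=\sup_{s\ne t\in[0,T]}|\mathbb{Y}_{s,t}|/|t-s|^{2\alpha}$ for two-parameter functions; $\|(B,\mathbb{B})\|_{\alpha,[0,T]}=\|B\|_{\alpha,[0,T]}+\|\mathbb{B}\|_{2\alpha,[0,T]}^{1/2}$. Rough path lift. $\mathbb{B}_{s,t}=(\mathbb{B}^{(i,j)}_{s,t})_{i,j=1}^r$, where for $i<j$, $\mathbb{B}^{(i,j)}_{s,t}$ is the $L^2$-limit, as the mesh tends to $0$, of $\sum_k B^{(i)}_{s,t_k}B^{(j)}_{t_k,t_{k+1}}$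 over partitions of $[s,t]$; $\mathbb{B}^{(i,i)}_{s,t}=\frac12(B^{(i)}_{s,t})^2$; and $\mathbb{B}^{(i,j)}_{s,t}=-\mathbb{B}^{(j,i)}_{s,t}+B^{(i)}_{s,t}B^{(j)}_{s,t}$ for $i>j$. Almost surely $(B,\mathbb{B})$ is an $\alpha$-Hölder geometric rough path. For a finite-dimensional space $E$, a pair $(Z,Z')$ with $Z\in C^\alpha([0,T],E)$ and $Z'\in C^\alpha([0,T],\mathcal L(\mathbb{R}^r,E))$ belongs to $\mathcal D^{2\alpha}_B([0,T],E)$ if the remainder $R^Z_{s,t}:=Z_{s,t}-Z'_sB_{s,t}$ satisfies $\|R^Z\|_{2\alpha,[0,T]}<\infty$. For $(Z,Z')\in\mathcal D_B^{2\alpha}([0,T],\mathcal L(\mathbb{R}^r,\mathbb{R}^d))$ the rough integral is $\int_0^tZ_sdB_s=\lim\sum_k(Z_{t_k}B_{t_k,t_{k+1}}+Z'_{t_k}\mathbb{B}_{t_k,t_{k+1}})$, the limit being over partitions of $[0,t]$ with mesh tending to $0$. $X^\varepsilon$ denotes the solution of $$X_t^\varepsilon=X_0+\int_0^tb(X_s^\varepsilon,\theta_0)ds+\varepsilon\int_0^t\sigma(X_s^\varepsilon)dB_s,\quad t\in[0,T],$$ meaning $(X^\varepsilon,\varepsilon\sigma(X^\varepsilon))\in\mathcal D_B^{2\alpha}([0,T],\mathbb{R}^d)$ and the equality holds a.s., the last integral being the rough integral of $\sigma(X^\varepsilon)$ with derivative $\varepsilon\nabla_x\sigma(X^\varepsilon)\sigma(X^\varepsilon)$.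 Thus $R^{X^\varepsilon}_{s,t}=X^\varepsilon_{s,t}-\varepsilon\sigma(X^\varepsilon_s)B_{s,t}$ and $R^{\sigma(X^\varepsilon)}_{s,t}=\sigma(X^\varepsilon_t)-\sigma(X_s^\varepsilon)-\varepsilon\nabla_x\sigma(X^\varepsilon_s)\sigma(X^\varepsilon_s)B_{s,t}$. The inequalities are understood pathwise, almost surely. *)

(* Defs.v *)
(* [R^n] is ['cV[R]_n], with the library norm (maximum of the absolute values of
   the entries; the same on matrices). *)
From HB Require Import structures.
From mathcomp Require Import all_boot all_order all_algebra.
From mathcomp Require Import all_classical all_reals all_analysis.

Set Implicit Arguments.
Unset Strict Implicit.
Unset Printing Implicit Defensive.
Import Order.TTheory GRing.Theory Num.Theory.
Import numFieldNormedType.Exports.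

Local Open Scope classical_set_scope.
Local Open Scope ring_scope.

(* nderive [:: v1; ..; vk] f x is the k-th derivative of f at x applied to
   (v1, .., vk).  Its operator norm is the supremum of these values over
   directions of norm at most 1, which is how derivatives are bounded below. *)
Fixpoint nderive (R : realType) (V W : normedModType R) (vs : seq V)
    (f : V -> W) : V -> W :=
  if vs is v :: vs' then 'D_v (nderive vs' f) else f.

Definition unit_dirs (R : realType) (V : normedModType R) (k : nat)
    (vs : seq V) : Prop :=
  (size vs <= k)%N /\ (forall v, v \in vs -> `|v| <= 1).

(* k times Frechet differentiable on the whole space, with the function and all
   derivatives up to order k bounded *)
Definition Cb (R : realType) (V W : normedModType R) (k : nat) (f : V -> W) :
    Prop :=
  (forall vs, (size vs < k)%N -> forall x, differentiable (nderive vs f) x) /\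
  (exists M : R, forall vs, unit_dirs k vs ->
     forall x, `|nderive vs f x| <= M).

(* nabla_x^j nabla_theta^i b (x, theta) applied to the directions us (x) and
   vs (theta), where j = size us and i = size vs *)
Definition mixed_derive (R : realType) (U V W : normedModType R)
    (us : seq U) (vs : seq V) (b : U -> V -> W) (x : U) (theta : V) : W :=
  nderive us (fun y => nderive vs (b y) theta) x.

(* C^{k,l}(U x Theta, W) for an open set Theta *)
Definition Cmixed (R : realType) (U V W : normedModType R) (k l : nat)
    (Theta : set V) (b : U -> V -> W) : Prop :=
  [/\ forall vs, (size vs < l)%N -> forall x theta, Theta theta ->
        differentiable (nderive vs (b x)) theta,
      forall us vs, (size us < k)%N -> (size vs <= l)%N ->
        forall x theta, Theta theta ->
        differentiable (mixed_derive us vs b ^~ theta) x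
    & forall us vs, (size us <= k)%N -> (size vs <= l)%N ->
        forall x theta, Theta theta ->
        {for (x, theta), continuous
           (fun p : U * V => mixed_derive us vs b p.1 p.2)}].

Section Sobolev.
Variables (R : realType) (m : nat).

Definition borelR := g_sigma_algebraType (@open 'cV[R]_m).

(* The library has no m-dimensional Lebesgue measure on ['cV_m]; it is the only
   Borel measure giving boxes their volume. *)
Definition is_lebesgue (lambda : {measure set borelR -> \bar R}) : Prop :=
  forall lo hi : 'cV[R]_m, (forall k, lo k 0 <= hi k 0) ->
    lambda [set x : 'cV[R]_m | forall k, lo k 0 <= x k 0 <= hi k 0] =
    (\prod_(k < m) (hi k 0 - lo k 0))%:E.

Definition test_function (Theta : set 'cV[R]_m) (phi : 'cV[R]_m -> R^o) :
    Prop :=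
  (forall vs x, differentiable (nderive vs phi) x) /\
  (exists K : set 'cV[R]_m,
     [/\ compact K, K `<=` Theta & forall x, ~ K x -> phi x = 0]).

Definition Lq (lambda : {measure set borelR -> \bar R}) (Theta : set 'cV[R]_m)
    (q : R) (u : 'cV[R]_m -> R) : Prop :=
  measurable_fun (Theta : set borelR) (u : borelR -> R) /\
  (\int[lambda]_(x in Theta) (`|u x| `^ q)%:E < +oo)%E.

(* u lies in W^{1,q}(Theta), with weak gradient g *)
Definition W1q (lambda : {measure set borelR -> \bar R})
    (Theta : set 'cV[R]_m) (q : R) (u : 'cV[R]_m -> R)
    (g : 'I_m -> 'cV[R]_m -> R) : Prop :=
  [/\ Lq lambda Theta q u,
      forall k, Lq lambda Theta q (g k)
    & forall k phi, test_function Theta phi ->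
        \int[lambda]_(x in Theta) (u x * 'D_(delta_mx k 0) phi x) =
        - \int[lambda]_(x in Theta) (g k x * phi x)].

Definition W1q_norm (lambda : {measure set borelR -> \bar R})
    (Theta : set 'cV[R]_m) (q : R) (u : 'cV[R]_m -> R)
    (g : 'I_m -> 'cV[R]_m -> R) : \bar R :=
  ((\int[lambda]_(x in Theta) (`|u x| `^ q)%:E +
    \sum_(k < m) \int[lambda]_(x in Theta) (`|g k x| `^ q)%:E) `^ q^-1)%E.

(* W^{1,q}(Theta) embeds continuously into C(closure Theta) *)
Definition sobolev_embedding (Theta : set 'cV[R]_m) (q : R) : Prop :=
  exists lambda : {measure set borelR -> \bar R}, is_lebesgue lambda /\
  exists K : R, forall u g, W1q lambda Theta q u g ->
    exists v : 'cV[R]_m -> R,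
      [/\ {within closure Theta, continuous v},
          {ae lambda, forall x, Theta x -> u x = v x}
        & forall x, closure Theta x ->
            (`|v x|%:E <= K%:E * W1q_norm lambda Theta q u g)%E].

End Sobolev.

Section Partitions.
Variable R : realType.

(* As in itv_partition, the partition a < s_0 < s_1 < .. = b is encoded by s. *)
Definition mesh (a b : R) (s : seq R) : R :=
  let t := nth b (a :: s) in
  \big[Num.max/0]_(0 <= k < size s) (t k.+1 - t k).

Definition partition_sum (V : zmodType) (a b : R) (f : R -> R -> V)
    (s : seq R) : V :=
  let t := nth b (a :: s) in \sum_(0 <= k < size s) f (t k) (t k.+1).

(* the filter "partitions of [a, b] with mesh tending to 0" *)
Definition mesh_to0 (a b : R) : set_system (seq R) :=
  fun A => exists2 delta : R, 0 < delta &
    forall s, itv_partition a b s -> mesh a b s < delta -> A s.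

Global Instance mesh_to0_filter (a b : R) : Filter (mesh_to0 a b).
Proof.
split.
- by exists 1.
- move=> A A' [e e0 eA] [e' e'0 eA']; exists (Num.min e e').
    by rewrite lt_min e0 e'0.
  by move=> s ps; rewrite lt_min => /andP[? ?]; split; [exact: eA|exact: eA'].
- by move=> A A' AA' [e e0 eA]; exists e => // s ps sm; apply/AA'/eA.
Qed.

End Partitions.

Section RoughPaths.
Variables (R : realType) (T : R).

Definition incr (V : zmodType) (Y : R -> V) (s t : R) : V := Y t - Y s.

Definition hnorm2 (V : normedModType R) (a : R) (Y : R -> R -> V) : \bar R :=
  ereal_sup [set x | exists s t, [/\ s \in `[0, T], t \in `[0, T], s != t
                                   & x = (`|Y s t| / `|t - s| `^ a)%:E]].

Definition hnorm (V : normedModType R) (a : R) (Y : R -> V) : \bar R :=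
  hnorm2 a (incr Y).

Definition rp_norm (r : nat) (a : R) (B : R -> 'cV[R]_r)
    (BB : R -> R -> 'M[R]_r) : \bar R :=
  (hnorm a B + hnorm2 (2 * a)%R BB `^ 2^-1)%E.

(* alpha-Hoelder regularity, Chen's relation and the first order chain rule *)
Definition geometric_rough_path (r : nat) (a : R) (B : R -> 'cV[R]_r)
    (BB : R -> R -> 'M[R]_r) : Prop :=
  [/\ (hnorm a B < +oo)%E, (hnorm2 (2 * a)%R BB < +oo)%E,
      forall s u t, s \in `[0, T] -> u \in `[0, T] -> t \in `[0, T] ->
        BB s t = BB s u + BB u t + incr B s u *m (incr B u t)^T
    & forall s t, s \in `[0, T] -> t \in `[0, T] ->
        BB s t + (BB s t)^T = incr B s t *m (incr B s t)^T].

(* An element A of L(R^r, E) is given by its values on the canonical basis. *)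
Definition lapp (r : nat) (E : normedModType R) (A : 'I_r -> E)
    (v : 'cV[R]_r) : E := \sum_(i < r) v i 0 *: A i.

Definition remainder (r : nat) (E : normedModType R) (B : R -> 'cV[R]_r)
    (Z : R -> E) (Z' : R -> 'I_r -> E) (s t : R) : E :=
  incr Z s t - lapp (Z' s) (incr B s t).

Definition controlled (r : nat) (E : normedModType R) (a : R)
    (B : R -> 'cV[R]_r) (Z : R -> E) (Z' : R -> 'I_r -> E) : Prop :=
  [/\ (hnorm a Z < +oo)%E, forall i, (hnorm a (Z' ^~ i) < +oo)%E
    & (hnorm2 (2 * a)%R (remainder B Z Z') < +oo)%E].

(* Z'_s BB_{s,t} is the sum over i, j of BB^{(i,j)}_{s,t} (Z'_s e_i) e_j. *)
Definition is_rough_integral (d r : nat) (B : R -> 'cV[R]_r)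
    (BB : R -> R -> 'M[R]_r) (Z : R -> 'M[R]_(d, r))
    (Z' : R -> 'I_r -> 'M[R]_(d, r)) (t : R) (I : 'cV[R]_d) : Prop :=
  partition_sum 0 t (fun u v => Z u *m incr B u v +
      \sum_(i < r) \sum_(j < r) BB u v i j *: col j (Z' u i)) s
    @[s --> mesh_to0 0 t] --> I.

(* the Gubinelli derivatives eps sigma(X) of X and
   eps (nabla sigma)(X) sigma(X) of sigma(X) *)
Definition gubX (d r : nat) (sigma : 'cV[R]_d -> 'M[R]_(d, r)) (eps : R)
    (X : R -> 'cV[R]_d) (s : R) (i : 'I_r) : 'cV[R]_d :=
  eps *: col i (sigma (X s)).

Definition gubS (d r : nat) (sigma : 'cV[R]_d -> 'M[R]_(d, r)) (eps : R)
    (X : R -> 'cV[R]_d) (s : R) (i : 'I_r) : 'M[R]_(d, r) :=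
  eps *: 'd sigma (X s) (col i (sigma (X s))).

(* dX = f(X) dt + eps sigma(X) dB, X_0 = x0, along one rough path (B, BB) *)
Definition rde_solution (d r : nat) (a : R) (x0 : 'cV[R]_d)
    (f : 'cV[R]_d -> 'cV[R]_d) (sigma : 'cV[R]_d -> 'M[R]_(d, r)) (eps : R)
    (B : R -> 'cV[R]_r) (BB : R -> R -> 'M[R]_r) (X : R -> 'cV[R]_d) : Prop :=
  controlled a B X (gubX sigma eps X) /\
  forall t, t \in `[0, T] -> exists2 I : 'cV[R]_d,
    is_rough_integral B BB (sigma \o X) (gubS sigma eps X) t I &
    X t = x0 + \col_(k < d) \int[lebesgue_measure]_(u in `[0, t]) (f (X u) k 0)
          + eps *: I.

End RoughPaths.

Section Probability.
Variables (R : realType) (disp : measure_display) (Omega : measurableType disp).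
Variables (P : probability Omega R) (T : R).

(* normal_prob with standard deviation 0 is not a Dirac mass in the library,
   hence the separate degenerate case. *)
Definition gaussian (Y : Omega -> R) : Prop :=
  (exists c : R, {ae P, forall w, Y w = c}) \/
  (exists mu s : R, 0 < s /\
     forall A : set R, measurable A -> P (Y @^-1` A) = normal_prob mu s A).

Definition gaussian_process (W : R -> {RV P >-> R}) : Prop :=
  forall n (t c : 'I_n -> R), (forall k, t k \in `[0, T]) ->
    gaussian (fun w => \sum_(k < n) c k * W (t k) w).

Definition is_fbm (H : R) (W : R -> {RV P >-> R}) : Prop :=
  [/\ gaussian_process W,
      forall t, t \in `[0, T] -> ('E_P[W t] = 0)%E,
      forall s t, s \in `[0, T] -> t \in `[0, T] ->
        ('E_P[fun w => (W s w * W t w)%R] =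
         (2^-1 * (s `^ (2 * H) + t `^ (2 * H) - `|t - s| `^ (2 * H)))%:E)%E
    & {ae P, forall w, {within `[0, T], continuous (fun t => W t w)}}].

(* mutual independence of the generated sigma-algebras; subfamilies are covered
   by taking the remaining events equal to the whole space *)
Definition independent_processes (r : nat) (W : 'I_r -> R -> {RV P >-> R}) :
    Prop :=
  forall E : 'I_r -> set Omega,
    (forall i, <<s [set A | exists t (D : set R),
       [/\ t \in `[0, T], measurable D & A = W i t @^-1` D]] >> (E i)) ->
    (P (\bigcap_(i in setT) E i) = \big[*%E/1]_(i < r) P (E i))%E.

Definition path_of (r : nat) (W : 'I_r -> R -> {RV P >-> R}) (w : Omega)
    (t : R) : 'cV[R]_r := \col_i W i t w.

Definition area_of (r : nat) (WW : 'I_r -> 'I_r -> R -> R -> {RV P >-> R})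
    (w : Omega) (s t : R) : 'M[R]_r := \matrix_(i, j) WW i j s t w.

(* The L^2 limits fix each WW i j s t (s <= t) only almost surely; the last
   clause selects the version whose paths are rough paths, and Chen's relation
   then determines it for s > t. *)
Definition is_lift (r : nat) (a : R) (W : 'I_r -> R -> {RV P >-> R})
    (WW : 'I_r -> 'I_r -> R -> R -> {RV P >-> R}) : Prop :=
  [/\ forall (i j : 'I_r) s t, (i < j)%N -> 0 <= s -> s <= t -> t <= T ->
        ('E_P[fun w => ((partition_sum s t (fun u v =>
             (W i u w - W i s w) * (W j v w - W j u w)) p
           - WW i j s t w) ^+ 2)%R])%E @[p --> mesh_to0 s t] --> (0 : \bar R),
      forall (i : 'I_r) s t, s \in `[0, T] -> t \in `[0, T] ->
        {ae P, forall w, WW i i s t w = 2^-1 * (W i t w - W i s w) ^+ 2},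
      forall (i j : 'I_r) s t, (j < i)%N -> s \in `[0, T] -> t \in `[0, T] ->
        {ae P, forall w, WW i j s t w =
           - WW j i s t w + (W i t w - W i s w) * (W j t w - W j s w)}
    & {ae P, forall w, geometric_rough_path T a (path_of W w) (area_of WW w)}].

End Probability.

(* Main.v *)
Require Import Defs.
From HB Require Import structures.
From mathcomp Require Import all_boot all_order all_algebra.
From mathcomp Require Import all_classical all_reals all_analysis.
From mathcomp Require Import ring lra.

Set Implicit Arguments.
Unset Strict Implicit.
Unset Printing Implicit Defensive.
Import Order.TTheory GRing.Theory Num.Theory.
Import numFieldNormedType.Exports.

Local Open Scope classical_set_scope.
Local Open Scope ring_scope.

(** The estimates are deterministic. They hold along every geometric rough path
    (B, BB) and every solution X driven by it, with constants that depend
    neither on the path nor on eps or theta0 (theorem rde_pathwise_bounds);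
    probability only contributes the null sets off which (B, BB) is a rough path
    and X solves the equation. Write rho for the rough path norm, RX for the
    remainder of X and Rsigma for that of sigma(X).

    Locally, on an interval [s, t], everything is controlled by a linear
    inequality for RX. By Chen's relation the defect of additivity of the germ
    sigma(X_s) B_{s,t} + Z'_s BB_{s,t} is made of Rsigma_{s,u} B_{u,t} and
    (Z'_u - Z'_s) BB_{u,t} (germ_defect). Splitting the increment of X into its
    Gubinelli part and RX before expanding sigma gives a bound for Rsigma which
    is linear in RX, with no quadratic term (remainder_sigma_norm_le). So if
    |RX_{p,q}| <= y (q - p)^(2 alpha) on [s, t], the defect is of order
    rho (y + rho^2) (q - p)^(3 alpha), and as 3 alpha > 1 summation along dyadic
    partitions compares the rough integral with its germ (sewing). Inserted in
    the equation, this returns the bound A + y / 2 in place of y as soon as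
    rho (t - s)^alpha is below a constant; since X is controlled, a finite y
    exists, and the optimal one is at most 2 A (absorb). The result is RX_local
    and X_local: for such intervals, with L a bound of the drift along X,
      |RX_{s,t}| <= 2 L (t - s) + C rho^2 (t - s)^(2 alpha),
      |X_{s,t}|  <= 2 L (t - s) + C rho (t - s)^alpha.

    Globally, cut [0, T] into n intervals of length T / n to which the local
    estimates apply; n can be taken of order 1 + rho^(1/alpha) (mesh_exists).
    Over one such interval the rough part of X moves by at most a constant, and
    the drift, b being Lipschitz in x uniformly in theta, grows at most linearly
    in X, so a discrete Gronwall argument bounds X by C n on [0, T] (X_sup).
    Adding up the increments over the intervals gives |X_{s,t}| <= C n
    (t - s)^alpha (X_holder). For the remainders, the local estimate covers times
    at distance less than T / n, and for the others (t - s)^(-alpha) <= C n turns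
    the first order bound into a second order one with constant C n^2
    (RX_holder, Rsigma_holder). Finally n^2 is at most
    C (1 + rho^(2/alpha)). *)

(** * Maximum norms of matrices *)

Section MatrixNorm.
Variable R : realType.

Lemma mx_norm_entry (m n : nat) (A : 'M[R]_(m, n)) i j : `|A i j| <= `|A|.
Proof.
rewrite [leRHS]/Num.Def.normr/= mx_normrE.
exact: (le_bigmax _ (fun ij => `|A ij.1 ij.2|) (i, j)).
Qed.

Lemma mx_norm_le (m n : nat) (A : 'M[R]_(m, n)) (c : R) :
  0 <= c -> (forall i j, `|A i j| <= c) -> `|A| <= c.
Proof.
move=> c0 Ac; rewrite [leLHS]/Num.Def.normr/= mx_normrE.
by apply: bigmax_le => // -[i j] _; exact: Ac.
Qed.

Lemma mx_norm_mulmx (m n p : nat) (A : 'M[R]_(m, n)) (B : 'M[R]_(n, p)) :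
  `|A *m B| <= n%:R * (`|A| * `|B|).
Proof.
apply: mx_norm_le => [|i j]; first by rewrite !mulr_ge0.
rewrite mxE (le_trans (ler_norm_sum _ _ _))//.
apply: (@le_trans _ _ (\sum_(k < n) `|A| * `|B|)).
  by apply: ler_sum => k _; rewrite normrM ler_pM// mx_norm_entry.
by rewrite sumr_const card_ord mulr_natl.
Qed.

Lemma mx_norm_col (m n : nat) (A : 'M[R]_(m, n)) j : `|col j A| <= `|A|.
Proof.
by apply: mx_norm_le => // i k; rewrite mxE mx_norm_entry.
Qed.

Lemma lapp_norm_le (r : nat) (E : normedModType R) (A : 'I_r -> E)
    (v : 'cV[R]_r) (c : R) :
  (forall i, `|A i| <= c) -> `|lapp A v| <= r%:R * (c * `|v|).
Proof.
move=> Ac; rewrite (le_trans (ler_norm_sum _ _ _))//.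
apply: (@le_trans _ _ (\sum_(k < r) c * `|v|)).
  by apply: ler_sum => k _; rewrite normrZ mulrC ler_pM// mx_norm_entry.
by rewrite sumr_const card_ord mulr_natl.
Qed.

End MatrixNorm.

(** * Bounds from first and second derivatives *)

Section Smooth.
Variables (R : realType) (d p q : nat).
Implicit Types (f : 'cV[R]_d -> 'M[R]_(p, q)) (x y g v : 'cV[R]_d).

(** The mean value theorem fails for vector-valued maps, but holds for each entry,
    which is enough for a maximum norm. *)
Lemma line_MVT f x g i j : (forall y, differentiable f y) ->
  exists2 c : R, 0 <= c <= 1 & (f (x + g) - f x) i j = ('D_g f (x + c *: g)) i j.
Proof.
move=> df.
have dfg y : derivable f y g by exact: diff_derivable.
pose phi (s : R) : R := f (x + s *: g) i j.
have quot (s : R) : (fun h : R => h^-1 *: (phi (h *: 1 + s) - phi s)) =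
    (fun h : R => h^-1 *: (f (h *: g + (x + s *: g)) i j - f (x + s *: g) i j)).
  apply/funext => h; rewrite /phi; congr (_ *: (f _ i j - _)).
  by rewrite scaler1 scalerDl addrCA.
have dphi (s : R) : is_derive s 1 phi (('D_g f (x + s *: g)) i j).
  have dfij : derivable (fun y => f y i j) (x + s *: g) g.
    by have /derivable_mxP := dfg (x + s *: g); apply.
  apply: DeriveDef; first by rewrite /derivable quot.
  by rewrite derive_mx// mxE /derive quot.
have [|c c01] := MVT_segment ler01 (fun s _ => dphi s).
  apply: continuous_subspaceT => s; apply: differentiable_continuous.
  by apply/derivable1_diffP; have := dphi s; case.
rewrite /phi scale1r scale0r addr0 subr0 mulr1 => e.
by exists c; [rewrite in_itv in c01 | rewrite mxE mxE e].
Qed.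

Lemma diff_lipschitz f (M : R) x y : 0 <= M ->
  (forall y, differentiable f y) ->
  (forall y v, `|'D_v f y| <= M * `|v|) -> `|f y - f x| <= M * `|y - x|.
Proof.
move=> M0 df fM; apply: mx_norm_le => [|i j]; first by rewrite mulr_ge0.
have [c _] := line_MVT x (y - x) i j df.
rewrite (_ : x + (y - x) = y); last by rewrite addrC subrK.
by move=> ->; rewrite (le_trans (mx_norm_entry _ _ _)).
Qed.

Lemma taylor1_norm_le f (M : R) x g : 0 <= M ->
  (forall y, differentiable f y) ->
  (forall v y, differentiable ('D_v f) y) ->
  (forall y v w, `|'D_w ('D_v f) y| <= M * `|v| * `|w|) ->
  `|f (x + g) - f x - 'D_g f x| <= M * `|g| ^+ 2.
Proof.
move=> M0 df ddf fM; apply: mx_norm_le => [|i j].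
  by rewrite mulr_ge0// exprn_ge0.
have [c /andP[c0 c1] e] := line_MVT x g i j df.
rewrite mxE e.
have -> : 'D_g f (x + c *: g) i j + (- 'D_g f x) i j =
          ('D_g f (x + c *: g) - 'D_g f x) i j by rewrite [in RHS]mxE.
apply: le_trans (mx_norm_entry _ _ _) _.
have DL := @diff_lipschitz ('D_g f) (M * `|g|) x (x + c *: g).
apply: le_trans (DL _ _ _) _ => //; first by rewrite mulr_ge0.
by rewrite addrAC subrr add0r normrZ ger0_norm// expr2
  [leRHS]mulrA ler_wpM2l ?mulr_ge0//
  ler_piMl.
Qed.

End Smooth.

Section CbBounds.
Variables (R : realType) (V W : normedModType R).

Lemma deriveZdir (f : V -> W) (x v : V) (k : R) : differentiable f x ->
  'D_(k *: v) f x = k *: 'D_v f x.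
Proof. by move=> df; rewrite !deriveE// linearZ. Qed.

(** Passes from directions of norm at most 1 to all directions by homogeneity. *)
Lemma dir_norm_le (f : V -> W) (x : V) (M : R) : differentiable f x ->
  (forall v, `|v| <= 1 -> `|'D_v f x| <= M) ->
  forall v, `|'D_v f x| <= M * `|v|.
Proof.
move=> df fM v; have [->|v0] := eqVneq v 0.
  by rewrite deriveE// linear0 !normr0 mulr0.
have nv : `|v| != 0 by rewrite normr_eq0.
rewrite [in leLHS](_ : v = `|v| *: (`|v|^-1 *: v)); last first.
  by rewrite scalerA divff// scale1r.
rewrite deriveZdir// normrZ normr_id mulrC ler_wpM2r// fM//.
by rewrite normrZ normfV normr_id mulVf.
Qed.

(** One constant for f and its first two derivatives, taken at least 1 so that
    products of bounds can be compared by their degree in M. *)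
Definition C2_bounded (f : V -> W) (M : R) : Prop := [/\ 1 <= M,
  (forall x, `|f x| <= M),
  (forall x, differentiable f x) /\ (forall v x, differentiable ('D_v f) x),
  (forall x v, `|'D_v f x| <= M * `|v|) &
  (forall x v w, `|'D_w ('D_v f) x| <= M * `|v| * `|w|)].

Lemma Cb_C2_bounded (f : V -> W) : Cb 3 f -> exists M : R, C2_bounded f M.
Proof.
move=> [df [M0 fM0]].
have df0 x : differentiable f x by exact: (df [::]).
have df1 v x : differentiable ('D_v f) x by exact: (df [:: v]).
pose M := Num.max 1 M0.
have fM vs : unit_dirs 3 vs -> forall x, `|nderive vs f x| <= M.
  by move=> uvs x; rewrite le_max fM0 ?orbT.
have M1 v x : `|'D_v f x| <= M * `|v|.
  apply: dir_norm_le => // {}v v1; apply: (fM [:: v]).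
  by split=> // w; rewrite inE => /eqP->.
exists M; split=> //; first by rewrite le_max lexx.
- by move=> x; apply: (fM [::]).
- move=> x v w; apply: dir_norm_le w => // w w1.
  have [->|v0] := eqVneq v 0.
    have -> : 'D_(0 : V) f = cst 0.
      by apply/funext => y; rewrite deriveE// linear0.
    by rewrite derive_cst !normr0 mulr0.
  have nv : `|v| != 0 by rewrite normr_eq0.
  have -> : 'D_v f = `|v| *: 'D_(`|v|^-1 *: v) f.
    apply/funext => y; rewrite /= fctE deriveZdir//.
    by rewrite scalerA divff// scale1r.
  rewrite deriveZ/=; last exact: diff_derivable.
  rewrite normrZ normr_id mulrC ler_wpM2r//.
  apply: (fM [:: w; `|v|^-1 *: v]); split=> // u; rewrite !inE => /orP[/eqP->//|/eqP->].
  by rewrite normrZ normfV normr_id mulVf.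
Qed.

End CbBounds.

(** * Partition sums and sewing *)

Section PartitionSums.
Variables (R : realType) (V : zmodType).
Implicit Types (f : R -> R -> V) (s : seq R) (a b c x : R).

Lemma partition_sum_cons f a b x s :
  partition_sum a b f (x :: s) = f a x + partition_sum x b f s.
Proof. by rewrite /partition_sum /= big_nat_recl. Qed.

Lemma partition_sum_cat f a b c s1 s2 :
  partition_sum a c f (s1 ++ s2) =
  partition_sum a b f s1 + partition_sum (last a s1) c f s2.
Proof.
elim: s1 a => [|x s1 IH] a /=; last by rewrite !partition_sum_cons IH addrA.
by rewrite {2}/partition_sum /= big_geq// add0r.
Qed.

Lemma mesh_cons a b x s : mesh a b (x :: s) = Num.max (x - a) (mesh x b s).
Proof. by rewrite /mesh /= big_nat_recl. Qed.

Lemma mesh_nil a b : mesh a b [::] = 0.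
Proof. by rewrite /mesh big_geq. Qed.

Lemma mesh_cat_lt a b c e s1 s2 :
  mesh a b s1 < e -> mesh (last a s1) c s2 < e -> mesh a c (s1 ++ s2) < e.
Proof.
elim: s1 a => [|x s1 IH] a //=.
by rewrite !mesh_cons !gt_max => /andP[-> /IH].
Qed.

End PartitionSums.

Section Sewing.
Variable R : realType.
Implicit Types (a b s t : R).

Fixpoint dyadic (n : nat) (a b : R) : seq R :=
  if n is k.+1 then dyadic k a ((a + b) / 2) ++ dyadic k ((a + b) / 2) b
  else [:: b].

Lemma dyadic_partition n a b : a < b -> itv_partition a b (dyadic n a b).
Proof.
elim: n a b => [|n IH] a b ab /=; first exact: itv_partition1.
by apply: (@itv_partition_cat _ _ _ ((a + b) / 2)); apply: IH; lra.
Qed.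

Lemma dyadic_mesh n a b e : a < b -> 0 < e ->
  (b - a) / 2 ^+ n < e -> mesh a b (dyadic n a b) < e.
Proof.
elim: n a b => [|n IH] a b ab e0 /=.
  by rewrite expr0 divr1 mesh_cons mesh_nil gt_max => ->.
have am : a < (a + b) / 2 by lra.
have mb : (a + b) / 2 < b by lra.
rewrite exprS invfM mulrA => abe.
have [_ /eqP lastE] := dyadic_partition n am.
apply: (@mesh_cat_lt _ _ ((a + b) / 2)).
  by apply: IH => //; rewrite (_ : _ - a = (b - a) / 2)//; lra.
by rewrite lastE; apply: IH => //; rewrite (_ : b - _ = (b - a) / 2)//; lra.
Qed.

Lemma dyadic_mesh_small a b e : a < b -> 0 < e ->
  exists n, mesh a b (dyadic n a b) < e.
Proof.
move=> ab e0; exists (Num.bound ((b - a) / e)); apply: dyadic_mesh => //.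
rewrite ltr_pdivrMr ?exprn_gt0// mulrC -ltr_pdivrMr//.
apply: lt_le_trans (archi_boundP _) _.
  by rewrite divr_ge0// ?subr_ge0 ltW.
by rewrite -natrX ler_nat ltnW// ltn_expl.
Qed.

Variables (V : normedModType R).
Implicit Types (Xi : R -> R -> V).

(** Sum of the geometric series of the defects met along the successive dyadic
    partitions: the defects at one level weigh at most 2 * 2^(- beta) times those
    of the level above. *)
Definition sewing_const (beta : R) : R := (1 - 2 * 2^-1 `^ beta)^-1.

Lemma sewing_contraction (beta : R) : 1 < beta -> 2 * 2^-1 `^ beta < 1 :> R.
Proof.
move=> b1; rewrite -mulr_powRB1 ?(lt_trans ltr01)// mulrA mulfV// mul1r.
apply: (@lt_le_trans _ _ (1 `^ (beta - 1))); last by rewrite powR1.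
rewrite gt0_ltr_powR ?subr_gt0 ?nnegrE ?invr_ge0//.
by rewrite invf_lt1// ltr1n.
Qed.

(** Only defects at midpoints occur in a dyadic partition. The induction splits
    [s, t] in halves and reproduces the constant, because sewing_const is the
    fixed point of c = 1 + 2 * 2^(- beta) * c. *)
Lemma dyadic_sum_le Xi (A beta : R) s t n : 1 < beta -> 0 <= A -> s < t ->
  (forall p q, s <= p -> p < q -> q <= t ->
     `|Xi p q - Xi p ((p + q) / 2) - Xi ((p + q) / 2) q| <= A * (q - p) `^ beta) ->
  `|partition_sum s t Xi (dyadic n s t) - Xi s t|
    <= sewing_const beta * A * (t - s) `^ beta.
Proof.
move=> b1 A0; have k1 := sewing_contraction b1.
elim: n s t => [|n IH] s t st dXi /=.
  rewrite partition_sum_cons /partition_sum big_geq// addr0 subrr normr0.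
  by rewrite !mulr_ge0 ?powR_ge0// invr_ge0 subr_ge0 ltW.
have [_ /eqP lastE] := @dyadic_partition n s ((s + t) / 2) ltac:(lra).
rewrite (@partition_sum_cat _ _ _ _ ((s + t) / 2)) lastE.
set u := (s + t) / 2 in lastE *.
have su : s < u by rewrite /u; lra.
have ut : u < t by rewrite /u; lra.
have I1 := IH s u su (fun p q sp pq qu => dXi p q sp pq (le_trans qu (ltW ut))).
have I2 := IH u t ut (fun p q sp pq qu => dXi p q (le_trans (ltW su) sp) pq qu).
have I3 := dXi s t (lexx _) st (lexx _); rewrite -/u in I3.
rewrite (_ : u - s = (t - s) * 2^-1) ?powRM in I1; [|lra..|by rewrite /u; lra].
rewrite (_ : t - u = (t - s) * 2^-1) ?powRM in I2; [|lra..|by rewrite /u; lra].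
set x := partition_sum _ _ _ _ in I1 *; set y := partition_sum _ _ _ _ in I2 *.
have -> : x + y - Xi s t = (x - Xi s u) + (y - Xi u t) - (Xi s t - Xi s u - Xi u t).
  rewrite -(addrA (Xi s t)) -opprD [X in _ = X - _]addrACA -opprD.
  by rewrite opprB addrA subrK.
apply: le_trans (ler_normB _ _) _.
apply: le_trans (lerD (ler_normD _ _) (lexx _)) _.
apply: le_trans (lerD (lerD I1 I2) I3) _.
set h := _ `^ _; set w := _ `^ _ in k1 *.
rewrite /sewing_const -/w.
have -> : A * h = (1 - 2 * w)^-1 * A * (h * (1 - 2 * w)).
  by field; rewrite lt0r_neq0// subr_gt0.
by rewrite -!mulrDr; lra.
Qed.

(** The integrals I u are only known as limits over partitions of [0, u]. A fine
    partition of [0, s] followed by a fine dyadic partition of [s, t] is a fine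
    partition of [0, t], so the dyadic sums over [s, t] approximate I t - I s. *)
Lemma sewing Xi (I : R -> V) (A beta T s t : R) : 1 < beta -> 0 <= A ->
  0 <= s -> s < t -> t <= T ->
  (forall p q, s <= p -> p < q -> q <= t ->
     `|Xi p q - Xi p ((p + q) / 2) - Xi ((p + q) / 2) q| <= A * (q - p) `^ beta) ->
  (forall u, u \in `[0, T] ->
     partition_sum 0 u Xi l @[l --> mesh_to0 0 u] --> I u) ->
  `|I t - I s - Xi s t| <= sewing_const beta * A * (t - s) `^ beta.
Proof.
move=> b1 A0 s0 st tT dXi cvgI.
have sT : s \in `[0, T] by rewrite in_itv /= s0 (le_trans (ltW st)).
have tT' : t \in `[0, T] by rewrite in_itv /= tT (le_trans s0)// ltW.
apply/ler_addgt0Pr => e e0.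
have e2 : 0 < e / 2 by rewrite divr_gt0.
have /cvgrPdist_lt/(_ _ e2)[d1 d10 H1] := cvgI _ sT.
have /cvgrPdist_lt/(_ _ e2)[d2 d20 H2] := cvgI _ tT'.
pose d := Num.min d1 d2.
have d0 : 0 < d by rewrite lt_min d10.
have dd1 : d <= d1 by rewrite ge_min lexx.
have dd2 : d <= d2 by rewrite ge_min lexx orbT.
have [p ps pm] : exists2 p, itv_partition 0 s p & mesh 0 s p < d.
  move: s0; rewrite le_eqVlt => /predU1P[<-|s0].
    by exists [::]; [split=> //=|rewrite mesh_nil].
  have [n nd] := dyadic_mesh_small s0 d0.
  by exists (dyadic n 0 s) => //; exact: dyadic_partition.
have [n nd] := dyadic_mesh_small st d0.
have pt := dyadic_partition n st.
have [_ /eqP lastE] := ps.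
have /= {}H1 := H1 p ps (lt_le_trans pm dd1).
have /= {}H2 := H2 (p ++ dyadic n s t) (itv_partition_cat ps pt).
have {}H2 := H2 (mesh_cat_lt (lt_le_trans pm dd2) _).
rewrite lastE in H2; have {}H2 := H2 (lt_le_trans nd dd2).
rewrite (@partition_sum_cat _ _ _ _ s) lastE in H2.
have D := dyadic_sum_le n b1 A0 st dXi.
set x := partition_sum _ _ _ p in H1 H2; set y := partition_sum _ _ _ _ in D H2.
have -> : I t - I s - Xi s t = (I t - (x + y)) - (I s - x) + (y - Xi s t).
  rewrite opprB [RHS]addrA; congr (_ - _).
  by rewrite -[RHS]addrA (addrAC x) addrA subrK.
have tri (a b c : V) : `|a - b + c| <= `|c| + (`|a| + `|b|).
  by rewrite addrC (le_trans (ler_normD _ _))// lerD2l ler_normB.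
by apply: le_trans (tri _ _ _) _; rewrite lerD// (splitr e) lerD// ltW.
Qed.
End Sewing.

(** * The drift *)

Section Drift.
Variables (R : realType) (d : nat).

Definition drift (g : R -> 'cV[R]_d) (t : R) : 'cV[R]_d :=
  \col_(k < d) \int[lebesgue_measure]_(u in `[0, t]) g u k 0.

Lemma drift_incr_le (g : R -> 'cV[R]_d) (T L s t : R) :
  (forall k, {within `[0, T], continuous (fun u => g u k 0 : R^o)}) ->
  0 <= s -> s <= t -> t <= T -> 0 <= L ->
  (forall u, s <= u <= t -> `|g u| <= L) ->
  `|drift g t - drift g s| <= L * (t - s).
Proof.
move=> cg s0 st tT L0 gL.
apply: mx_norm_le => [|k j]; first by rewrite mulr_ge0// subr_ge0.
rewrite !mxE.
have int0T : lebesgue_measure.-integrable `[0, T] (EFin \o (fun u => g u k 0)).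
  by apply: continuous_compact_integrable => //; exact: segment_compact.
have int0t : lebesgue_measure.-integrable `[0, t] (EFin \o (fun u => g u k 0)).
  apply: integrableS int0T => //.
  by apply: subset_itvl; rewrite bnd_simp.
have intst : lebesgue_measure.-integrable `]s, t] (EFin \o (fun u => g u k 0)).
  by apply: integrableS int0t => //; apply: subset_itvr; rewrite bnd_simp.
have must : lebesgue_measure (`]s, t]%classic : set R) = (t - s)%:E.
  rewrite lebesgue_measure_itv/= lte_fin.
  by move: st; rewrite le_eqVlt => /predU1P[->|st]; rewrite ?ltxx ?st ?subrr -?EFinB.
have finst : (lebesgue_measure (`]s, t]%classic : set R) < +oo)%E.
  by rewrite must ltry.
rewrite Rintegral_itvB ?bnd_simp//.
apply: le_trans (le_normr_Rintegral _ _) _ => //.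
apply: (@le_trans _ _ (\int[lebesgue_measure]_(u in `]s, t]) cst L u)).
  apply: le_Rintegral => //.
  - by have := integrable_norm intst.
  - apply: measurable_bounded_integrable => //=.
    by exists L; split; rewrite ?num_real// => M LM x _ /=; rewrite ger0_norm// ltW.
  - move=> x /=; rewrite in_itv/= => /andP[sx xt].
    by rewrite (le_trans (mx_norm_entry _ _ _))// gL// (ltW sx).
rewrite Rintegral_cst// ler_wpM2l// le_eqVlt; apply/orP; left; apply/eqP.
by have /(congr1 fine) := must.
Qed.

End Drift.

(** * Germs of rough integrals *)

Section Germ.
Variables (R : realType) (d r : nat).
Implicit Types (Z : 'I_r -> 'M[R]_(d, r)) (A : 'M[R]_r) (u v : 'cV[R]_r).

Definition area_term (Z' : 'I_r -> 'M[R]_(d, r)) A : 'cV[R]_d :=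
  \sum_(i < r) \sum_(j < r) A i j *: col j (Z' i).

Lemma area_termD (Z' : 'I_r -> 'M[R]_(d, r)) A1 A2 :
  area_term Z' (A1 + A2) = area_term Z' A1 + area_term Z' A2.
Proof.
rewrite /area_term -big_split; apply: eq_bigr => i _.
by rewrite -big_split; apply: eq_bigr => j _; rewrite mxE scalerDl.
Qed.

Lemma area_termB Z1 Z2 A :
  area_term (fun i => Z1 i - Z2 i) A = area_term Z1 A - area_term Z2 A.
Proof.
rewrite /area_term -sumrB; apply: eq_bigr => i _; rewrite -sumrB.
by apply: eq_bigr => j _; rewrite -scalerBr; congr (_ *: _);
  apply/matrixP => k l; rewrite !mxE.
Qed.

(** Matches the last term of Chen's relation with the Gubinelli part of the
    increment of the integrand. *)
Lemma area_term_tensor (Z' : 'I_r -> 'M[R]_(d, r)) u v :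
  area_term Z' (u *m v^T) = lapp Z' u *m v.
Proof.
rewrite /area_term /lapp mulmx_suml; apply: eq_bigr => i _.
rewrite -scalemxAl; apply/matrixP => k l; rewrite ord1 !mxE summxE mulr_sumr.
by apply: eq_bigr => j _; rewrite !mxE big_ord1 mxE -mulrA (mulrC (v j 0)).
Qed.

Lemma area_term_norm_le (Z' : 'I_r -> 'M[R]_(d, r)) A (c : R) :
  0 <= c -> (forall i, `|Z' i| <= c) ->
  `|area_term Z' A| <= r%:R ^+ 2 * (c * `|A|).
Proof.
move=> c0 Zc; rewrite (le_trans (ler_norm_sum _ _ _))//.
rewrite expr2 -mulrA mulr_natl -[X in _ *+ X]card_ord -sumr_const.
apply: ler_sum => i _; rewrite (le_trans (ler_norm_sum _ _ _))//.
rewrite mulr_natl -[X in _ *+ X]card_ord -sumr_const.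
apply: ler_sum => j _; rewrite normrZ mulrC ler_pM// ?mx_norm_entry//.
by rewrite (le_trans (mx_norm_col _ _)).
Qed.

(** The summand of is_rough_integral. *)
Definition germ (B : R -> 'cV[R]_r) (BB : R -> R -> 'M[R]_r)
    (Z : R -> 'M[R]_(d, r)) (Z' : R -> 'I_r -> 'M[R]_(d, r)) (s t : R) : 'cV[R]_d :=
  Z s *m incr B s t + area_term (Z' s) (BB s t).

(** The first order terms cancel by Chen's relation, leaving a remainder times an
    increment and an increment times an area, both of order 3 alpha. *)
Lemma germ_defect B BB (Z : R -> 'M[R]_(d, r))
    (Z' : R -> 'I_r -> 'M[R]_(d, r)) (s u t : R) :
  BB s t = BB s u + BB u t + incr B s u *m (incr B u t)^T ->
  germ B BB Z Z' s t - germ B BB Z Z' s u - germ B BB Z Z' u t =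
  - (remainder B Z Z' s u *m incr B u t)
  - area_term (fun i => Z' u i - Z' s i) (BB u t).
Proof.
move=> chen; rewrite /germ chen !area_termD area_term_tensor area_termB.
have -> : incr B s t = incr B s u + incr B u t by rewrite /incr [RHS]addrC subrKA.
rewrite /remainder [incr Z s u]/incr !mulmxBl mulmxDr.
move: (Z s *m incr B s u) (Z s *m incr B u t) (Z u *m incr B u t) (lapp _ _ *m _).
move: (area_term _ _) (area_term _ _) (area_term _ _) => x1 x2 x3 x4 x5 x6 x7.
by apply/matrixP => i j; rewrite !mxE; ring.
Qed.

Lemma lapp_mulmx (A : 'M[R]_(d, r)) (e : R) v :
  lapp (fun i => e *: col i A) v = e *: (A *m v).
Proof.
apply/matrixP => k l; rewrite ord1 /lapp summxE !mxE mulr_sumr.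
by apply: eq_bigr => i _; rewrite !mxE; ring.
Qed.

End Germ.

(** * The coefficient sigma along a controlled path *)

Section SmoothCoefficient.
Variables (R : realType) (d r : nat) (sigma : 'cV[R]_d -> 'M[R]_(d, r)) (M : R).
Hypothesis sigmaM : C2_bounded sigma M.

Let M1 : 1 <= M. Proof. by case: sigmaM. Qed.
Let sigma_le x : `|sigma x| <= M. Proof. by case: sigmaM. Qed.
Let dsigma x : differentiable sigma x.
Proof. by case: sigmaM => _ _ [dsigma _]. Qed.
Let ddsigma v x : differentiable ('D_v sigma) x.
Proof. by case: sigmaM => _ _ [_ ddsigma]. Qed.
Let Dsigma_le x v : `|'D_v sigma x| <= M * `|v|.
Proof. by case: sigmaM => _ _ _. Qed.
Let DDsigma_le x v w : `|'D_w ('D_v sigma) x| <= M * `|v| * `|w|.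
Proof. by case: sigmaM => _ _ _ _. Qed.

Let M0 : 0 <= M. Proof. exact: le_trans M1. Qed.

Let dsigmaE z v : 'D_v sigma z = 'd sigma z v.
Proof. by rewrite deriveE. Qed.

Let DsigmaB x v w : 'D_(v - w) sigma x = 'D_v sigma x - 'D_w sigma x.
Proof. by rewrite !dsigmaE; exact: linearB. Qed.

Lemma sigma_lipschitz x y : `|sigma y - sigma x| <= M * `|y - x|.
Proof. exact: diff_lipschitz. Qed.

(** The direction and the base point are changed one after the other. *)
Lemma dsigma_sigma_lipschitz i x y :
  `|'d sigma y (col i (sigma y)) - 'd sigma x (col i (sigma x))|
    <= 2 * M ^+ 2 * `|y - x|.
Proof.
rewrite -[X in X - _]dsigmaE. rewrite -[X in _ - X]dsigmaE.
have -> : 'D_(col i (sigma y)) sigma y - 'D_(col i (sigma x)) sigma x =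
    ('D_(col i (sigma y)) sigma y - 'D_(col i (sigma y)) sigma x)
    + 'D_(col i (sigma y) - col i (sigma x)) sigma x.
  by rewrite DsigmaB addrA subrK.
apply: le_trans (ler_normD _ _) _.
have -> : 2 * M ^+ 2 * `|y - x| = M * M * `|y - x| + M * (M * `|y - x|) by ring.
apply: lerD.
  have := @diff_lipschitz _ _ _ _ ('D_(col i (sigma y)) sigma)
    (M * `|col i (sigma y)|) x y.
  move=> /(_ (mulr_ge0 M0 (normr_ge0 _)) (ddsigma _)) H.
  apply: le_trans (H (fun z v => DDsigma_le z _ v)) _.
  by rewrite ler_wpM2r// ler_wpM2l// (le_trans (mx_norm_col _ _)).
apply: le_trans (Dsigma_le _ _) _; rewrite ler_wpM2l//.
rewrite -linearB (le_trans (mx_norm_col _ _))//.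
exact: sigma_lipschitz.
Qed.

Variables (eps : R) (X : R -> 'cV[R]_d).
Hypothesis eps01 : 0 < eps <= 1.

Let eps_norm : `|eps| <= 1.
Proof. by case/andP: eps01 => e0 e1; rewrite gtr0_norm. Qed.

Lemma gubX_norm_le s i : `|gubX sigma eps X s i| <= M.
Proof.
rewrite normrZ -[leRHS]mul1r ler_pM//.
by rewrite (le_trans (mx_norm_col _ _)).
Qed.

Lemma gubS_norm_le s i : `|gubS sigma eps X s i| <= M ^+ 2.
Proof.
rewrite normrZ -[leRHS]mul1r ler_pM// -dsigmaE.
apply: le_trans (Dsigma_le _ _) _; rewrite expr2 ler_wpM2l//.
by rewrite (le_trans (mx_norm_col _ _)).
Qed.

Lemma gubS_lipschitz s u i :
  `|gubS sigma eps X u i - gubS sigma eps X s i| <= 2 * M ^+ 2 * `|incr X s u|.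
Proof.
rewrite -scalerBr normrZ -[leRHS]mul1r ler_pM//.
exact: dsigma_sigma_lipschitz.
Qed.

(** The Gubinelli derivative of sigma(X) is the derivative of sigma in the
    direction of the Gubinelli part of the increment of X. *)
Lemma lapp_gubS s (v : 'cV[R]_r) :
  lapp (gubS sigma eps X s) v = 'D_(lapp (gubX sigma eps X s) v) sigma (X s).
Proof.
rewrite deriveE// /lapp linear_sum; apply: eq_bigr => i _ /=.
by rewrite /gubX /gubS -2!dsigmaE !deriveZdir.
Qed.

(** With x = X_s, G the Gubinelli part and Q the remainder of the increment of X,
    the left-hand side is sigma(x + G + Q) - sigma(x + G), estimated by the
    Lipschitz constant, plus the Taylor remainder of sigma in the direction G.
    Expanding sigma directly in the direction G + Q would leave a term |Q|^2,
    which the absorption argument cannot handle. *)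
Lemma remainder_sigma_norm_le (B : R -> 'cV[R]_r) s t :
  `|remainder B (sigma \o X) (gubS sigma eps X) s t| <=
  M * `|remainder B X (gubX sigma eps X) s t|
  + M * `|lapp (gubX sigma eps X s) (incr B s t)| ^+ 2.
Proof.
rewrite /remainder lapp_gubS; set G := lapp _ _; rewrite /incr /=.
have -> : sigma (X t) - sigma (X s) - 'D_G sigma (X s) =
    (sigma (X t) - sigma (X s + G)) +
    (sigma (X s + G) - sigma (X s) - 'D_G sigma (X s)).
  by rewrite -[LHS]addrA -[X in _ = _ + X]addrA [RHS]addrA subrK.
apply: le_trans (ler_normD _ _) _; apply: lerD.
  by apply: le_trans (sigma_lipschitz _ _) _; rewrite opprD addrA.
exact: taylor1_norm_le.
Qed.

End SmoothCoefficient.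

(** * Local estimates *)

Section Absorb.
Variable R : realType.

(** An a priori finite quantity that is bounded by A plus a fraction of any of its
    bounds is at most A / (1 - th): apply this to the supremum. *)
Lemma absorb (I : Type) (E : set I) (g : I -> R) (A th : R) :
  th < 1 -> (exists y, forall i, E i -> g i <= y) ->
  (forall y, (forall i, E i -> g i <= y) ->
     forall i, E i -> g i <= A + th * y) ->
  forall i, E i -> g i <= A / (1 - th).
Proof.
move=> th1 [y0 gy0] self i Ei.
have supg : has_sup (g @` E).
  split; first by exists (g i), i.
  by exists y0 => _ [j Ej <-]; exact: gy0.
set y := sup (g @` E).
have gy j : E j -> g j <= y.
  by move=> Ej; apply: ub_le_sup; [case: supg | exists j].
have : y <= A + th * y.
  by apply: ge_sup; [case: supg | move=> _ [j Ej <-]; exact: self].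
have th1' : 0 < 1 - th by rewrite subr_gt0.
move=> yA; apply: le_trans (gy i Ei) _; rewrite ler_pdivlMr//; lra.
Qed.

Lemma powR2M (x a : R) : x `^ (2 * a) = (x `^ a) ^+ 2.
Proof. by rewrite mulrC powRrM powR_mulrn// powR_ge0. Qed.

Lemma powR3M (x a : R) : x `^ (3 * a) = (x `^ a) ^+ 3.
Proof. by rewrite mulrC powRrM powR_mulrn// powR_ge0. Qed.

End Absorb.

Section RoughDifferentialEquation.
Variables (R : realType) (d r : nat) (sigma : 'cV[R]_d -> 'M[R]_(d, r)) (M : R).
Hypothesis r0 : (0 < r)%N.
Hypothesis sigmaM : C2_bounded sigma M.

Variables (T al : R).
Hypothesis al13 : 3^-1 < al.
Hypothesis al12 : al < 2^-1.

Variables (B : R -> 'cV[R]_r) (BB : R -> R -> 'M[R]_r) (rho : R).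
Hypothesis rho0 : 0 <= rho.
Hypothesis B_le : forall s t : R, 0 <= s -> s < t -> t <= T ->
  `|incr B s t| <= rho * (t - s) `^ al.
Hypothesis BB_le : forall s t : R, 0 <= s -> s < t -> t <= T ->
  `|BB s t| <= rho ^+ 2 * (t - s) `^ (2 * al).
Hypothesis chen : forall s u t : R, 0 <= s -> s < u -> u < t -> t <= T ->
  BB s t = BB s u + BB u t + incr B s u *m (incr B u t)^T.

Variables (eps : R) (X Dr I : R -> 'cV[R]_d) (f : 'cV[R]_d -> 'cV[R]_d) (x0 : 'cV[R]_d).
Hypothesis eps01 : 0 < eps <= 1.
Hypothesis rough_integral : forall u : R, u \in `[0, T] ->
  partition_sum 0 u (germ B BB (sigma \o X) (gubS sigma eps X)) l
    @[l --> mesh_to0 0 u] --> I u.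
Hypothesis equation : forall t : R, 0 <= t -> t <= T -> X t = x0 + Dr t + eps *: I t.
Hypothesis drift_le : forall s t L : R, 0 <= s -> s <= t -> t <= T -> 0 <= L ->
  (forall u : R, s <= u <= t -> `|f (X u)| <= L) -> `|Dr t - Dr s| <= L * (t - s).

Let RX := remainder B X (gubX sigma eps X).
Let Rsigma := remainder B (sigma \o X) (gubS sigma eps X).
Let G s t := lapp (gubX sigma eps X s) (incr B s t).

Hypothesis RX_fin : exists y, forall s t : R, 0 <= s -> s < t -> t <= T ->
  `|RX s t| <= y * (t - s) `^ (2 * al).

(** Bounds the linear map v |-> sigma(x) v for the maximum norms. *)
Definition op_bound : R := r%:R * M.
(** Chosen so that rho (t - s)^al <= small_scale makes the sewing error at most
    (y + rho^2) / 2 * (t - s)^(2 al) when RX is bounded with constant y. *)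
Definition small_scale : R := (6 * sewing_const (3 * al) * op_bound ^+ 3)^-1.
Local Notation W := op_bound.

Let M1 : 1 <= M. Proof. by case: sigmaM. Qed.
Let M0 : 0 <= M. Proof. exact: le_trans M1. Qed.

Let r1 : 1 <= r%:R :> R. Proof. by rewrite ler1n. Qed.

Let W1 : 1 <= W.
Proof. by rewrite -[leLHS]mul1r ler_pM. Qed.

Let al0 : 0 < al. Proof. by apply: lt_trans al13; rewrite invr_gt0. Qed.

Let beta1 : 1 < 3 * al. Proof. by rewrite mulrC -ltr_pdivrMr// mul1r. Qed.

Let S1 : 1 <= sewing_const (3 * al).
Proof.
have k1 := sewing_contraction beta1.
rewrite /sewing_const invf_ge1 ?subr_gt0// lerBlDr lerDl mulr_ge0// powR_ge0.
Qed.

Lemma small_scale_gt0 : 0 < small_scale.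
Proof.
by rewrite invr_gt0 mulr_gt0 ?exprn_gt0 ?mulr_gt0// (lt_le_trans ltr01).
Qed.

Let W3 : 1 <= W ^+ 3. Proof. by rewrite exprn_ege1. Qed.

Lemma small_scale_le1 : small_scale <= 1.
Proof.
rewrite invf_le1; last by rewrite -invr_gt0 small_scale_gt0.
by rewrite -[leLHS]mul1r ler_pM// -[leLHS]mul1r ler_pM// ler1n.
Qed.

Lemma G_norm_le (s t : R) : 0 <= s -> s < t -> t <= T ->
  `|G s t| <= W * rho * (t - s) `^ al.
Proof.
move=> s0 st tT; rewrite /G.
apply: le_trans (lapp_norm_le (c := M) _ _) _ => [i|].
  exact: (gubX_norm_le sigmaM).
by rewrite /W -!mulrA ler_wpM2l// ler_wpM2l// B_le.
Qed.

Let X_split s t : incr X s t = RX s t + G s t.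
Proof. by rewrite /RX /remainder subrK. Qed.

(** With h = (q - p)^al, RX contributes y rho h^3 through Rsigma and y rho^2 h^4
    through the area; rho h <= 1 makes the latter no worse than the former. *)
Lemma germ_defect_le (p u q y : R) : 0 <= p -> p < u -> u < q -> q <= T -> 0 <= y ->
  rho * (q - p) `^ al <= 1 -> `|RX p u| <= y * (u - p) `^ (2 * al) ->
  let Xi := germ B BB (sigma \o X) (gubS sigma eps X) in
  `|Xi p q - Xi p u - Xi u q| <=
    3 * W ^+ 3 * rho * (y + rho ^+ 2) * (q - p) `^ (3 * al).
Proof.
move=> p0 pu uq qT y0; rewrite powR3M powR2M.
have u0 : 0 <= u by rewrite (le_trans p0)// ltW.
have uT : u <= T by rewrite (le_trans _ qT)// ltW.
have hpu : (u - p) `^ al <= (q - p) `^ al.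
  by apply: ge0_ler_powR; rewrite ?nnegrE ?(ltW al0)//; lra.
have huq : (q - u) `^ al <= (q - p) `^ al.
  by apply: ge0_ler_powR; rewrite ?nnegrE ?(ltW al0)//; lra.
have hpu0 : 0 <= (u - p) `^ al by exact: powR_ge0.
have huq0 : 0 <= (q - u) `^ al by exact: powR_ge0.
have GG := G_norm_le p0 pu uT.
have BU := B_le u0 uq qT.
have BBU := BB_le u0 uq qT; rewrite powR2M in BBU.
move: hpu huq; set h := (q - p) `^ al; set h1 := (u - p) `^ al; set h2 := (q - u) `^ al.
rewrite -/h1 -/h2 in GG BU BBU hpu0 huq0 *.
move=> h1h h2h rh1 RXpu.
have h0 : 0 <= h by exact: powR_ge0.
have {}RXpu : `|RX p u| <= y * h ^+ 2.
  by apply: le_trans RXpu _; rewrite ler_wpM2l// lerXn2r ?nnegrE.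
have {}GG : `|G p u| <= W * rho * h.
  by apply: le_trans GG _; rewrite ler_wpM2l// mulr_ge0// (le_trans _ W1).
have {}BU : `|incr B u q| <= rho * h.
  by apply: le_trans BU _; rewrite ler_wpM2l.
have {}BBU : `|BB u q| <= rho ^+ 2 * h ^+ 2.
  by apply: le_trans BBU _; rewrite ler_wpM2l ?exprn_ge0// lerXn2r ?nnegrE.
have Xpu : `|incr X p u| <= y * h ^+ 2 + W * rho * h.
  by rewrite X_split (le_trans (ler_normD _ _))// lerD.
have Rs : `|Rsigma p u| <= M * (y * h ^+ 2) + M * (W * rho * h) ^+ 2.
  apply: le_trans (remainder_sigma_norm_le sigmaM eps X B p u) _.
  rewrite lerD// ler_wpM2l// lerXn2r// ?nnegrE//.
  by rewrite (le_trans _ GG).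
rewrite /= (germ_defect _ _ (chen p0 pu uq qT)).
apply: le_trans (ler_normB _ _) _; rewrite normrN.
have E1 := mx_norm_mulmx (Rsigma p u) (incr B u q).
have c0 : 0 <= 2 * M ^+ 2 * `|incr X p u| by rewrite !mulr_ge0.
have E2 := area_term_norm_le (BB u q) c0
  (gubS_lipschitz sigmaM X eps01 p u).
apply: le_trans (lerD E1 E2) _.
have {}E1 : r%:R * (`|Rsigma p u| * `|incr B u q|) <=
    r%:R * ((M * (y * h ^+ 2) + M * (W * rho * h) ^+ 2) * (rho * h)).
  by rewrite ler_wpM2l// ler_pM.
have {}E2 : r%:R ^+ 2 * (2 * M ^+ 2 * `|incr X p u| * `|BB u q|) <=
    r%:R ^+ 2 * (2 * M ^+ 2 * (y * h ^+ 2 + W * rho * h) * (rho ^+ 2 * h ^+ 2)).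
  rewrite ler_wpM2l ?exprn_ge0// ler_pM// ?mulr_ge0 ?exprn_ge0//.
  by rewrite ler_wpM2l// ?mulr_ge0 ?exprn_ge0.
apply: le_trans (lerD E1 E2) _.
have -> : r%:R * ((M * (y * h ^+ 2) + M * (W * rho * h) ^+ 2) * (rho * h)) +
    r%:R ^+ 2 * (2 * M ^+ 2 * (y * h ^+ 2 + W * rho * h) * (rho ^+ 2 * h ^+ 2)) =
    (rho * h ^+ 3) * (W * y + W ^+ 3 * rho ^+ 2
       + 2 * W ^+ 2 * (y * (rho * h) + W * rho ^+ 2)).
  by rewrite /W; ring.
have -> : 3 * W ^+ 3 * rho * (y + rho ^+ 2) * h ^+ 3 =
  (rho * h ^+ 3) * (W ^+ 3 * y + W ^+ 3 * rho ^+ 2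
    + 2 * W ^+ 2 * (W * y + W * rho ^+ 2)) by ring.
have W0 : 0 <= W by rewrite (le_trans _ W1).
rewrite ler_wpM2l ?mulr_ge0 ?exprn_ge0// lerD// ?lerD2r.
  by rewrite ler_wpM2r// -[leLHS]mulr1 exprS ler_wpM2l// exprn_ege1.
rewrite ler_wpM2l ?mulr_ge0 ?exprn_ge0// lerD2r.
by rewrite mulrC ler_wpM2r// (le_trans rh1).
Qed.

Let Xi := germ B BB (sigma \o X) (gubS sigma eps X).

Let RX_decomposition (p q : R) : 0 <= p -> p < q -> q <= T ->
  RX p q = (Dr q - Dr p) + eps *: ((I q - I p - Xi p q)
     + area_term (gubS sigma eps X p) (BB p q)).
Proof.
move=> p0 pq qT; rewrite /RX /remainder.
have -> : incr X p q = (Dr q - Dr p) + eps *: (I q - I p).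
  rewrite /incr !equation// ?(le_trans p0) ?(le_trans _ qT) 1?ltW//.
  by apply/matrixP => i j; rewrite !mxE; ring.
rewrite (lapp_mulmx (sigma (X p)) eps) /Xi /germ /=.
move: (_ *m _) (area_term _ _) => v1 v2.
by apply/matrixP => i j; rewrite !mxE; ring.
Qed.

(** The quantity to absorb is the supremum of |RX_{p,q}| / (q - p)^(2 al) over all
    subintervals [p, q] of [s, t], not only [s, t] itself, because the sewing
    error on [p, q] involves the remainders on its subintervals. *)
Lemma RX_local (s t L : R) : 0 <= s -> s < t -> t <= T ->
  rho * (t - s) `^ al <= small_scale -> 0 <= L ->
  (forall u, s <= u <= t -> `|f (X u)| <= L) ->
  `|RX s t| <= 2 * L * (t - s) + 4 * W ^+ 2 * rho ^+ 2 * (t - s) `^ (2 * al).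
Proof.
move=> s0 st tT small L0 fL.
pose E := [set pq : R * R | [/\ s <= pq.1, pq.1 < pq.2 & pq.2 <= t]].
pose g (pq : R * R) := `|RX pq.1 pq.2| / (pq.2 - pq.1) `^ (2 * al).
pose A := L * (t - s) `^ (1 - 2 * al) + 2 * W ^+ 2 * rho ^+ 2.
have pos (p q : R) : p < q -> 0 < (q - p) `^ (2 * al).
  by move=> pq; rewrite powR_gt0// subr_gt0.
have gE p q y : p < q ->
    (g (p, q) <= y) = (`|RX p q| <= y * (q - p) `^ (2 * al)).
  by move=> pq; rewrite /g /= ler_pdivrMr ?pos.
have a12 : 0 < 1 - 2 * al by rewrite subr_gt0 mulrC -ltr_pdivlMr// mul1r.
have : g (s, t) <= A / (1 - 2^-1).
  apply: (@absorb _ _ E) => //; first by rewrite invf_lt1 ?ltr1n.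
    have [y yP] := RX_fin; exists y => -[p q] [/= sp pq qt].
    by rewrite gE// yP ?(le_trans s0)// (le_trans qt).
  move=> y gy [p q] Epq; have [/= sp pq qt] := Epq.
  have y0 : 0 <= y.
    by apply: le_trans (gy _ Epq); rewrite /g divr_ge0// powR_ge0.
  have p0 : 0 <= p by exact: le_trans sp.
  have qT : q <= T by exact: le_trans tT.
  rewrite gE// RX_decomposition//.
  have h_le : (q - p) `^ al <= (t - s) `^ al.
    by apply: ge0_ler_powR; rewrite ?nnegrE ?(ltW al0)//; lra.
  have rh : rho * (q - p) `^ al <= small_scale.
    by apply: le_trans small; rewrite ler_wpM2l.
  have D : `|Dr q - Dr p| <= L * (q - p).
    apply: drift_le => //; first exact: ltW.
    by move=> u /andP[pu uq]; rewrite fL// (le_trans sp)// (le_trans uq).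
  have W0 : 0 <= W by rewrite (le_trans _ W1).
  have A0 : 0 <= 3 * W ^+ 3 * rho * (y + rho ^+ 2).
    by rewrite !mulr_ge0 ?addr_ge0 ?exprn_ge0.
  have J : `|I q - I p - Xi p q| <= sewing_const (3 * al) *
      (3 * W ^+ 3 * rho * (y + rho ^+ 2)) * (q - p) `^ (3 * al).
    apply: (sewing beta1 A0 p0 pq qT _ rough_integral) => p' q' pp' pq' qq'.
    have p'u : p' < (p' + q') / 2 by lra.
    have uq' : (p' + q') / 2 < q' by lra.
    apply: germ_defect_le => //; [exact: le_trans pp'|exact: le_trans qT| |].
      apply: le_trans small_scale_le1; apply: le_trans small; rewrite ler_wpM2l//.
      by apply: ge0_ler_powR; rewrite ?nnegrE ?(ltW al0)//; lra.
    rewrite -gE//; apply: gy; split => //=; first exact: le_trans pp'.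
    by rewrite (le_trans (ltW uq'))// (le_trans qq').
  have AR := area_term_norm_le (BB p q) (exprn_ge0 2 M0)
    (gubS_norm_le sigmaM X eps01 p).
  have {}AR : `|area_term (gubS sigma eps X p) (BB p q)| <=
      W ^+ 2 * rho ^+ 2 * (q - p) `^ (2 * al).
    apply: le_trans AR _.
    rewrite (_ : W ^+ 2 * _ * _ = r%:R ^+ 2 * (M ^+ 2 *
      (rho ^+ 2 * (q - p) `^ (2 * al)))); last by rewrite /W; ring.
    by rewrite ler_wpM2l ?exprn_ge0// ler_wpM2l ?exprn_ge0// BB_le.
  apply: le_trans (ler_normD _ _) _; rewrite normrZ.
  apply: le_trans (lerD D (ler_piMl _ _)) _ => //.
    by case/andP: eps01 => e0 e1; rewrite gtr0_norm.
  apply: le_trans (lerD (lexx _) (ler_normD _ _)) _.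
  apply: le_trans (lerD (lexx _) (lerD J AR)) _.
  have -> : L * (q - p) = L * (q - p) `^ (1 - 2 * al) * (q - p) `^ (2 * al).
    rewrite -mulrA -powRD ?subrK ?powRr1 ?subr_ge0 ?(ltW pq)//.
    by rewrite oner_eq0.
  have dr_le : L * (q - p) `^ (1 - 2 * al) <= L * (t - s) `^ (1 - 2 * al).
    by rewrite ler_wpM2l//; apply: ge0_ler_powR; rewrite ?nnegrE ?(ltW a12)//; lra.
  rewrite powR3M powR2M; move: rh; set h := (q - p) `^ al => rh.
  have h0 : 0 <= h by exact: powR_ge0.
  have half : 3 * sewing_const (3 * al) * W ^+ 3 * (rho * h) <= 2^-1.
    have c0 : 0 < 3 * sewing_const (3 * al) * W ^+ 3.
      by rewrite !mulr_gt0// (lt_le_trans ltr01).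
    have -> : 2^-1 = 3 * sewing_const (3 * al) * W ^+ 3 * small_scale.
      rewrite /small_scale; field; rewrite gt_eqF ?(lt_le_trans ltr01)//=.
      by rewrite gt_eqF ?(lt_le_trans ltr01).
    by rewrite ler_pM2l.
  have -> : sewing_const (3 * al) * (3 * W ^+ 3 * rho * (y + rho ^+ 2)) * h ^+ 3 =
     (3 * sewing_const (3 * al) * W ^+ 3 * (rho * h)) * ((y + rho ^+ 2) * h ^+ 2).
    by ring.
  have yr0 : 0 <= (y + rho ^+ 2) * h ^+ 2 by rewrite mulr_ge0 ?addr_ge0 ?exprn_ge0.
  have h20 : 0 <= h ^+ 2 by rewrite exprn_ge0.
  have W2 : rho ^+ 2 <= W ^+ 2 * rho ^+ 2.
    by rewrite ler_peMl ?exprn_ge0// exprn_ege1.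
  apply: le_trans (lerD (ler_wpM2r h20 dr_le) (lerD (ler_wpM2r yr0 half) (lexx _))) _.
  rewrite (_ : _ + _ = (L * (t - s) `^ (1 - 2 * al) +
    (2^-1 * (y + rho ^+ 2) + W ^+ 2 * rho ^+ 2)) * h ^+ 2); last by ring.
  have rr0 : 0 <= rho ^+ 2 by rewrite exprn_ge0.
  by rewrite ler_wpM2r// /A; lra.
rewrite gE// => /le_trans; apply.
have tsE : (t - s) `^ (1 - 2 * al) * (t - s) `^ (2 * al) = t - s.
  by rewrite -powRD ?subrK ?powRr1 ?subr_ge0 ?(ltW st)// oner_eq0.
rewrite /A (_ : 1 - 2^-1 = 2^-1); last by lra.
rewrite -[X in 2 * L * X]tsE le_eqVlt; apply/orP; left; apply/eqP.
by field.
Qed.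

Lemma X_local (s t L : R) : 0 <= s -> s < t -> t <= T ->
  rho * (t - s) `^ al <= small_scale -> 0 <= L ->
  (forall u, s <= u <= t -> `|f (X u)| <= L) ->
  `|incr X s t| <= 2 * L * (t - s) + 5 * W ^+ 2 * (rho * (t - s) `^ al).
Proof.
move=> s0 st tT small L0 fL; rewrite X_split.
apply: le_trans (ler_normD _ _) _.
apply: le_trans (lerD (RX_local s0 st tT small L0 fL) (G_norm_le s0 st tT)) _.
rewrite powR2M -addrA lerD2l.
have {}small := le_trans small small_scale_le1.
have h0 : 0 <= (t - s) `^ al by exact: powR_ge0.
move: ((t - s) `^ al) small h0 => h rh h0.
have rh0 : 0 <= rho * h by rewrite mulr_ge0.
have W0 : 0 <= W by rewrite (le_trans _ W1).
have E1 : W ^+ 2 * ((rho * h) * (rho * h)) <= W ^+ 2 * (rho * h).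
  by rewrite ler_wpM2l ?exprn_ge0// ler_piMl.
have E2 : W * (rho * h) <= W ^+ 2 * (rho * h).
  by rewrite ler_wpM2r// expr2 ler_peMl.
rewrite (_ : 4 * _ * _ * _ = 4 * (W ^+ 2 * ((rho * h) * (rho * h)))); last by ring.
by rewrite -(mulrA W) -(mulrA 5); lra.
Qed.

(** * From local to global estimates *)

Variable K : R.
Hypothesis K0 : 0 < K.
Hypothesis T0 : 0 < T.
Hypothesis f_le : forall x, `|f x| <= K * (1 + `|x|).
Hypothesis X0 : X 0 = x0.
Hypothesis X_fin : exists y, forall t : R, 0 <= t -> t <= T -> `|X t| <= y.

Variable n : nat.
Hypothesis n0 : (0 < n)%N.
Let delta : R := T / n%:R.
Hypothesis delta_small : rho * delta `^ al <= small_scale.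
Hypothesis K_delta : 4 * K * delta <= 1.

Let n1 : 1 <= n%:R :> R. Proof. by rewrite ler1n. Qed.
Let ngt0 : 0 < n%:R :> R. Proof. by rewrite ltr0n. Qed.
Let W0 : 0 <= W. Proof. exact: le_trans W1. Qed.
Let delta0 : 0 < delta. Proof. by rewrite divr_gt0. Qed.

Let short (s t : R) : s <= t -> t - s <= delta -> rho * (t - s) `^ al <= small_scale.
Proof.
move=> st std; apply: le_trans delta_small; rewrite ler_wpM2l//.
by apply: ge0_ler_powR; rewrite ?nnegrE ?subr_ge0 ?(ltW al0) ?(ltW delta0).
Qed.

(** The drift over [s, t] is bounded through the supremum of X over [s, t] itself,
    which is absorbed since 2 K delta <= 1/2; the factor 1 / (1 - 2 K delta) is
    then at most exp (4 K delta). *)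
Lemma X_sup_step (s t v : R) : 0 <= s -> t <= T -> t - s <= delta ->
  s <= v <= t ->
  1 + `|X v| <= expR (4 * K * delta) * (1 + `|X s| + 5 * W ^+ 2).
Proof.
move=> s0 tT std svt.
pose th := 2 * K * delta.
have th0 : 0 <= th by rewrite /th !mulr_ge0// ltW.
have th2 : th <= 2^-1 by rewrite /th; move: K_delta; lra.
pose A := 1 + `|X s| + 5 * W ^+ 2.
have A0 : 0 <= A by rewrite !addr_ge0// mulr_ge0// exprn_ge0.
have : 1 + `|X v| <= A / (1 - th).
  apply: (@absorb _ _ [set v | s <= v <= t] (fun v => 1 + `|X v|)) => //.
  - by lra.
  - have [y yP] := X_fin; exists (1 + y) => u /andP[su ut]; rewrite lerD2l.
    by rewrite yP ?(le_trans s0)// (le_trans ut).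
  - move=> y yP u /= /andP[su ut].
    have y0 : 0 <= y.
      by apply: le_trans (yP u _); rewrite ?addr_ge0//= su.
    move: su; rewrite le_eqVlt => /predU1P[<-|su].
      have W20 : 0 <= 5 * W ^+ 2 by rewrite mulr_ge0// exprn_ge0.
      have thy0 : 0 <= th * y by rewrite mulr_ge0.
      by rewrite /A; lra.
    have usd : u - s <= delta by rewrite (le_trans _ std)// lerD2r.
    have uT : u <= T by exact: le_trans tT.
    have Ky0 : 0 <= K * y by rewrite mulr_ge0// ltW.
    have loc := X_local s0 su uT (short (ltW su) usd) Ky0 _.
    have {}loc : `|incr X s u| <=
        2 * (K * y) * (u - s) + 5 * W ^+ 2 * (rho * (u - s) `^ al).
      apply: loc => w /andP[sw wu]; apply: le_trans (f_le _) _.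
      by rewrite ler_pM2l// yP//= sw (le_trans wu).
    have Xu : `|X u| <= `|X s| + `|incr X s u|.
      by rewrite (le_trans _ (ler_normD _ _))// /incr addrC subrK.
    have E1 : 2 * (K * y) * (u - s) <= th * y.
      rewrite (_ : th * y = 2 * (K * y) * delta); last by rewrite /th; ring.
      by rewrite ler_wpM2l// mulr_ge0.
    have E2 : 5 * W ^+ 2 * (rho * (u - s) `^ al) <= 5 * W ^+ 2.
      rewrite ler_piMr ?mulr_ge0 ?exprn_ge0//.
      exact: le_trans (short (ltW su) usd) small_scale_le1.
    by rewrite /A; lra.
move=> /le_trans; apply; rewrite mulrC ler_wpM2r//.
apply: le_trans (expR_ge1Dx _).
rewrite -[leLHS]mul1r ler_pdivrMr; last by lra.
rewrite (_ : 4 * K * delta = 2 * th); last by rewrite /th; ring.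
have : 0 <= th * (1 - 2 * th) by rewrite mulr_ge0//; lra.
by lra.
Qed.

(** Discrete Gronwall inequality over the intervals [j delta, (j + 1) delta]. *)
Lemma X_sup_iter (k : nat) (v : R) : 0 <= v -> v <= T -> v <= k%:R * delta ->
  1 + `|X v| <= expR (k%:R * (4 * K * delta)) * (1 + `|x0| + 5 * W ^+ 2 * k%:R).
Proof.
elim: k v => [|k IH] v v0 vT.
  rewrite mul0r => v0'; have -> : v = 0 by apply/eqP; rewrite eq_le v0' v0.
  by rewrite X0 mul0r expR0 mulr0 addr0 mul1r.
have E0 : 0 <= 4 * K * delta by rewrite !mulr_ge0// ltW.
have W20 : 0 <= 5 * W ^+ 2 by rewrite mulr_ge0// exprn_ge0.
have e1 : 1 <= expR (4 * K * delta).
  by apply: le_trans (expR_ge1Dx _); rewrite lerDl.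
have ek : 1 <= expR (k%:R * (4 * K * delta)).
  by apply: le_trans (expR_ge1Dx _); rewrite lerDl mulr_ge0.
move=> vk.
have -> : k.+1%:R * (4 * K * delta) = k%:R * (4 * K * delta) + 4 * K * delta.
  by rewrite -natr1; ring.
have -> : 5 * W ^+ 2 * k.+1%:R = 5 * W ^+ 2 * k%:R + 5 * W ^+ 2.
  by rewrite -natr1; ring.
rewrite expRD.
set e := expR (4 * K * delta) in e1 *; set E := expR _ in ek IH *.
have c0 : 0 <= 1 + `|x0| + 5 * W ^+ 2 * k%:R by rewrite !addr_ge0// mulr_ge0.
case: (leP v (k%:R * delta)) => vk'.
  apply: le_trans (IH _ v0 vT vk') _; apply: ler_pM => //.
  - by rewrite (le_trans _ ek).
  - by rewrite ler_peMr// (le_trans _ ek).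
  - by rewrite addrA lerDl.
have kd0 : 0 <= k%:R * delta by rewrite mulr_ge0// ltW.
have vkd : v - k%:R * delta <= delta.
  by rewrite lerBlDl; move: vk; rewrite -natr1 mulrDl mul1r.
apply: le_trans (X_sup_step kd0 vT vkd _) _; first by rewrite lexx ltW.
have {}IH := IH _ kd0 (le_trans (ltW vk') vT) (lexx _).
apply: le_trans (ler_wpM2l (le_trans ler01 e1) (lerD IH (lexx _))) _.
rewrite addrA; move: c0 W20; set a := 1 + _ + _; set w := 5 * _ => c0 W20.
rewrite (_ : E * e * (a + w) = e * (E * a + E * w)); last by ring.
by rewrite ler_wpM2l ?(le_trans ler01 e1)// lerD2l ler_peMl.
Qed.

Definition sup_const : R := expR (4 * K * T) * (1 + `|x0| + 5 * W ^+ 2).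

Lemma X_sup (v : R) : 0 <= v -> v <= T -> 1 + `|X v| <= sup_const * n%:R.
Proof.
move=> v0 vT.
have dn : n%:R * delta = T by rewrite /delta mulrC divfK// lt0r_neq0.
have := X_sup_iter v0 vT; move=> /(_ n); rewrite dn => /(_ vT) /le_trans; apply.
rewrite (_ : n%:R * (4 * K * delta) = 4 * K * T); last by rewrite -dn; ring.
rewrite /sup_const -[leRHS]mulrA ler_wpM2l ?expR_ge0//.
by rewrite [leRHS]mulrDl lerD2r ler_peMr// addr_ge0.
Qed.
Definition drift_const : R := 2 * K * sup_const.

Let sup_const_ge0 : 0 <= sup_const.
Proof.
by rewrite mulr_ge0 ?expR_ge0// !addr_ge0// mulr_ge0// exprn_ge0.
Qed.

Let drift_const_ge0 : 0 <= drift_const.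
Proof. by rewrite mulr_ge0// mulr_ge0// ltW. Qed.

Let f_bound (u : R) : 0 <= u -> u <= T -> `|f (X u)| <= K * (sup_const * n%:R).
Proof.
move=> u0 uT; apply: le_trans (f_le _) _.
by rewrite ler_wpM2l ?(ltW K0)// X_sup.
Qed.

Let L_ge0 : 0 <= K * (sup_const * n%:R).
Proof. by rewrite mulr_ge0 ?(ltW K0)// mulr_ge0. Qed.

Lemma X_short (s t : R) : 0 <= s -> s < t -> t <= T -> t - s <= delta ->
  `|incr X s t| <= drift_const * n%:R * (t - s)
                   + 5 * W ^+ 2 * (rho * (t - s) `^ al).
Proof.
move=> s0 st tT std.
have -> : drift_const * n%:R = 2 * (K * (sup_const * n%:R)).
  by rewrite /drift_const; ring.
apply: X_local => //; first exact: short (ltW st) std.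
by move=> u /andP[su ut]; rewrite f_bound ?(le_trans s0)// (le_trans ut).
Qed.

Lemma RX_short (s t : R) : 0 <= s -> s < t -> t <= T -> t - s <= delta ->
  `|RX s t| <= drift_const * n%:R * (t - s)
               + 4 * W ^+ 2 * rho ^+ 2 * (t - s) `^ (2 * al).
Proof.
move=> s0 st tT std.
have -> : drift_const * n%:R = 2 * (K * (sup_const * n%:R)).
  by rewrite /drift_const; ring.
apply: RX_local => //; first exact: short (ltW st) std.
by move=> u /andP[su ut]; rewrite f_bound ?(le_trans s0)// (le_trans ut).
Qed.

(** Each step of length delta contributes at most a constant to the rough part of
    the increment, as rho delta^al <= 1. *)
Lemma X_steps (k : nat) (s t : R) : 0 <= s -> s <= t -> t <= T ->
  t - s <= k%:R * delta ->
  `|incr X s t| <= drift_const * n%:R * (t - s) + 5 * W ^+ 2 * k%:R.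
Proof.
have W20 : 0 <= 5 * W ^+ 2 by rewrite mulr_ge0// exprn_ge0.
have Ln : 0 <= drift_const * n%:R by rewrite mulr_ge0.
elim: k t => [|k IH] t s0 st tT.
  rewrite mul0r subr_le0 => ts; have -> : t = s by apply/eqP; rewrite eq_le ts.
  by rewrite /incr subrr normr0 subrr mulr0 mulr0 addr0.
have -> : k.+1%:R * delta = k%:R * delta + delta by rewrite -natr1; ring.
have -> : 5 * W ^+ 2 * k.+1%:R = 5 * W ^+ 2 * k%:R + 5 * W ^+ 2.
  by rewrite -natr1; ring.
move=> tk.
have key (u : R) : s <= u -> u <= t -> t - u <= delta ->
    `|incr X u t| <= drift_const * n%:R * (t - u) + 5 * W ^+ 2.
  move=> su; rewrite le_eqVlt => /predU1P[->|ut] utd.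
    by rewrite /incr subrr normr0 subrr mulr0 add0r.
  apply: le_trans (X_short (le_trans s0 su) ut tT utd) _.
  rewrite lerD2l ler_piMr//.
  exact: le_trans (short (ltW ut) utd) small_scale_le1.
have [tsd|dts] := leP (t - s) delta.
  apply: le_trans (key s (lexx _) st tsd) _.
  by rewrite lerD2l lerDr mulr_ge0.
have su : s <= t - delta by lra.
have ut : t - delta <= t by rewrite lerBlDr lerDl ltW.
have utd : t - (t - delta) <= delta by rewrite opprB addrC subrK.
have {key}H2 := key _ su ut utd.
have {IH}H1 : `|incr X s (t - delta)| <=
    drift_const * n%:R * (t - delta - s) + 5 * W ^+ 2 * k%:R.
  by apply: IH => //; [exact: le_trans tT|lra].
have -> : incr X s t = incr X s (t - delta) + incr X (t - delta) t.
  by rewrite /incr [RHS]addrC subrKA.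
apply: le_trans (ler_normD _ _) _.
apply: le_trans (lerD H1 H2) _.
rewrite le_eqVlt; apply/orP; left; apply/eqP; ring.
Qed.

(** inv_scale * n dominates both delta^(- al) and rho. *)
Definition inv_scale : R := T `^ (- al).

Let scale_ge0 : 0 <= inv_scale. Proof. exact: powR_ge0. Qed.

Let al1 : al <= 1.
Proof. by apply: le_trans (ltW al12) _; rewrite invf_le1// ler1n. Qed.

Let delta_inv_le : delta `^ (- al) <= inv_scale * n%:R.
Proof.
rewrite /delta powRM ?invr_ge0 ?(ltW T0) ?(ltW ngt0)// /inv_scale ler_wpM2l ?powR_ge0//.
by rewrite -[n%:R^-1]powR_inv1 ?(ltW ngt0)// -powRrM mulN1r opprK ler1_powR.
Qed.

Let rho_le : rho <= inv_scale * n%:R.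
Proof.
apply: le_trans delta_inv_le.
rewrite powRN -[leRHS]mul1r ler_pdivlMr ?powR_gt0//.
exact: le_trans delta_small small_scale_le1.
Qed.

(** The rough part of the increment is bounded through 10 W^2 / T for t - s > delta,
    when at most 2 (t - s) n / T steps join s to t, and through the last summand
    for t - s <= delta. *)
Definition holder_const : R :=
  (drift_const + 10 * W ^+ 2 / T) * T `^ (1 - al) + 5 * W ^+ 2 * inv_scale.

(** In order: drift and rough part of RX_local for times at distance at most
    delta; RX estimated by the increment of X and its Gubinelli part for other
    times; the correction for reversing the order of s and t. *)
Definition remainder_const : R :=
  drift_const * T `^ (1 - 2 * al) + 4 * W ^+ 2 * inv_scale ^+ 2
  + (holder_const + W * inv_scale) * inv_scale + W * holder_const * inv_scale.

Definition sigma_remainder_const : R := M * (remainder_const + W ^+ 2 * inv_scale ^+ 2).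

Let split_pow (a x : R) : 0 < x -> x = x `^ (1 - a) * x `^ a.
Proof.
by move=> xgt0; rewrite -powRD ?subrK ?powRr1 ?(ltW xgt0)// oner_eq0.
Qed.

Let long_pow (a : R) (s t : R) : a <= 1 -> 0 <= s -> s < t -> t <= T ->
  (t - s) `^ (1 - a) <= T `^ (1 - a).
Proof.
move=> a1 s0 st tT; apply: ge0_ler_powR; rewrite ?nnegrE ?subr_ge0 ?(ltW st) ?(ltW T0)//.
by rewrite lerBlDr (le_trans tT)// lerDl.
Qed.

Lemma holder_const_ge0 : 0 <= holder_const.
Proof.
rewrite addr_ge0 ?mulr_ge0 ?powR_ge0 ?exprn_ge0//.
by rewrite addr_ge0// divr_ge0 ?(ltW T0)// mulr_ge0 ?exprn_ge0.
Qed.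

Lemma remainder_const_ge0 : 0 <= remainder_const.
Proof.
have h0 := holder_const_ge0.
have p1 : 0 <= drift_const * T `^ (1 - 2 * al) by rewrite mulr_ge0 ?powR_ge0.
have p2 : 0 <= 4 * W ^+ 2 * inv_scale ^+ 2 by rewrite !mulr_ge0 ?exprn_ge0.
have p3 : 0 <= (holder_const + W * inv_scale) * inv_scale.
  by rewrite mulr_ge0// addr_ge0// mulr_ge0.
have p4 : 0 <= W * holder_const * inv_scale by rewrite mulr_ge0// mulr_ge0.
by rewrite /remainder_const; lra.
Qed.

Lemma sigma_remainder_const_ge0 : 0 <= sigma_remainder_const.
Proof.
by rewrite mulr_ge0// addr_ge0 ?remainder_const_ge0// mulr_ge0 ?exprn_ge0.
Qed.

(** The drift is Lipschitz in time, so it is traded for a Hoelder bound at the cost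
    of a power of T. *)
Let X_holder_lt (s t : R) : 0 <= s -> s < t -> t <= T ->
  `|incr X s t| <= holder_const * n%:R * (t - s) `^ al.
Proof.
move=> s0 st tT.
have ts0 : 0 < t - s by rewrite subr_gt0.
have h0 : 0 <= (t - s) `^ al by exact: powR_ge0.
have Tb := long_pow al1 s0 st tT.
have W20 : 0 <= W ^+ 2 by rewrite exprn_ge0.
have lin (c : R) : 0 <= c ->
    c * n%:R * (t - s) <= c * T `^ (1 - al) * n%:R * (t - s) `^ al.
  move=> c0; rewrite [X in _ * X <= _](split_pow al ts0) mulrA ler_wpM2r//.
  by rewrite mulrAC ler_wpM2r// ler_wpM2l.
have [std|dts] := leP (t - s) delta.
  apply: le_trans (X_short s0 st tT std) _.
  have rh : 5 * W ^+ 2 * (rho * (t - s) `^ al) <=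
      5 * W ^+ 2 * (inv_scale * n%:R * (t - s) `^ al).
    by rewrite ler_wpM2l ?mulr_ge0// ler_wpM2r.
  apply: le_trans (lerD (lin _ drift_const_ge0) rh) _.
  rewrite (_ : _ + _ =
    (drift_const * T `^ (1 - al) + 5 * W ^+ 2 * inv_scale) * n%:R * (t - s) `^ al);
    last by ring.
  rewrite /holder_const.
  rewrite ler_wpM2r// ler_wpM2r// lerD2r ler_wpM2r ?powR_ge0// lerDl.
  by rewrite divr_ge0 ?(ltW T0)// mulr_ge0.
pose k := (Num.truncn ((t - s) / delta)).+1.
have dts0 : 0 <= (t - s) / delta by rewrite divr_ge0 ?(ltW ts0) ?(ltW delta0).
have tsk : t - s <= k%:R * delta.
  by rewrite -ler_pdivrMr// ltW// truncnS_gt.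
have kts : k%:R <= 2 * (t - s) * n%:R / T.
  have : (Num.truncn ((t - s) / delta))%:R <= (t - s) / delta.
    by rewrite truncn_le.
  have one : 1 <= (t - s) / delta by rewrite ler_pdivlMr// mul1r ltW.
  rewrite (_ : 2 * (t - s) * n%:R / T = 2 * ((t - s) / delta)); last first.
    by rewrite /delta; field; rewrite !gt_eqF.
  by rewrite /k -natr1; lra.
apply: le_trans (X_steps s0 (ltW st) tT tsk) _.
have k5 : 5 * W ^+ 2 * k%:R <= 5 * W ^+ 2 * (2 * (t - s) * n%:R / T).
  by rewrite ler_wpM2l// mulr_ge0.
apply: le_trans (lerD (lexx _) k5) _.
rewrite (_ : _ + _ = (drift_const + 10 * W ^+ 2 / T) * n%:R * (t - s)); last first.
  by field; rewrite gt_eqF.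
apply: le_trans (lin _ _) _.
  by rewrite addr_ge0// divr_ge0 ?(ltW T0)// mulr_ge0.
by rewrite ler_wpM2r// ler_wpM2r// /holder_const lerDl mulr_ge0// mulr_ge0.
Qed.

Let nn : n%:R <= n%:R ^+ 2 :> R.
Proof. by rewrite expr2 ler_peMr// ltW. Qed.

(** At distance at least delta, 1 <= delta^(- al) (t - s)^al gives the missing
    factor (t - s)^al. *)
Let RX_holder_lt (s t : R) : 0 <= s -> s < t -> t <= T ->
  `|RX s t| <= (remainder_const - W * holder_const * inv_scale) * n%:R ^+ 2
               * (t - s) `^ (2 * al).
Proof.
move=> s0 st tT; rewrite /remainder_const addrK.
have ts0 : 0 < t - s by rewrite subr_gt0.
have h0 : 0 <= (t - s) `^ al by exact: powR_ge0.
have a2 : 2 * al <= 1 by rewrite mulrC -ler_pdivlMr// mul1r ltW.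
have Tb := long_pow a2 s0 st tT.
have C0 := holder_const_ge0.
have W20 : 0 <= W ^+ 2 by rewrite exprn_ge0.
have p1 : 0 <= drift_const * T `^ (1 - 2 * al) by rewrite mulr_ge0 ?powR_ge0.
have p2 : 0 <= 4 * W ^+ 2 * inv_scale ^+ 2 by rewrite !mulr_ge0 ?exprn_ge0.
have p3 : 0 <= (holder_const + W * inv_scale) * inv_scale.
  by rewrite !mulr_ge0// addr_ge0// mulr_ge0.
have n20 : 0 <= n%:R ^+ 2 :> R by rewrite exprn_ge0.
have [std|dts] := leP (t - s) delta.
  apply: le_trans (RX_short s0 st tT std) _.
  rewrite [X in _ * X + _](split_pow (2 * al) ts0).
  have h20 : 0 <= (t - s) `^ (2 * al) by exact: powR_ge0.
  rewrite mulrA -mulrDl ler_wpM2r//.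
  have q1 : drift_const * n%:R * (t - s) `^ (1 - 2 * al) <=
      drift_const * T `^ (1 - 2 * al) * n%:R ^+ 2.
    rewrite mulrAC; apply: ler_pM => //; last by rewrite ler_wpM2l.
    by rewrite mulr_ge0 ?powR_ge0.
  have q2 : 4 * W ^+ 2 * rho ^+ 2 <= 4 * W ^+ 2 * inv_scale ^+ 2 * n%:R ^+ 2.
    rewrite -[leRHS]mulrA -exprMn ler_wpM2l ?mulr_ge0//.
    by rewrite lerXn2r ?nnegrE// mulr_ge0.
  apply: le_trans (lerD q1 q2) _; by rewrite -mulrDl ler_wpM2r// lerDl.
have -> : RX s t = incr X s t - G s t by rewrite X_split addrK.
apply: le_trans (ler_normB _ _) _.
apply: le_trans (lerD (X_holder_lt s0 st tT) (G_norm_le s0 st tT)) _.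
have hh : (t - s) `^ al <= inv_scale * n%:R * (t - s) `^ (2 * al).
  rewrite powR2M expr2 mulrA ler_peMl//.
  apply: le_trans (_ : delta `^ (- al) * (t - s) `^ al <= _); last by rewrite ler_wpM2r.
  rewrite powRN mulrC ler_pdivlMr ?powR_gt0// mul1r.
  by apply: ge0_ler_powR; rewrite ?nnegrE ?(ltW al0) ?(ltW delta0) ?(ltW ts0) ?(ltW dts).
have Wr : W * rho * (t - s) `^ al <= W * (inv_scale * n%:R) * (t - s) `^ al.
  by rewrite ler_wpM2r// ler_wpM2l.
apply: le_trans (lerD (lexx _) Wr) _.
rewrite [leLHS](_ : _ = (holder_const + W * inv_scale) * n%:R * (t - s) `^ al);
  last by ring.
apply: le_trans (ler_wpM2l _ hh) _.
  by rewrite mulr_ge0// addr_ge0// mulr_ge0.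
rewrite (_ : _ * _ * (_ * _) = (holder_const + W * inv_scale) * inv_scale *
  n%:R ^+ 2 * (t - s) `^ (2 * al)); last by ring.
by rewrite ler_wpM2r ?powR_ge0// ler_wpM2r// lerDr addr_ge0.
Qed.

Let incrN (k : nat) (Y : R -> 'cV[R]_k) (s t : R) : incr Y s t = - incr Y t s.
Proof. by rewrite /incr opprB. Qed.

Let inT (s : R) : s \in `[0, T] -> 0 <= s /\ s <= T.
Proof. by rewrite in_itv => /andP. Qed.

Lemma X_holder (s t : R) : s \in `[0, T] -> t \in `[0, T] -> s != t ->
  `|incr X s t| <= holder_const * n%:R * `|t - s| `^ al.
Proof.
move=> /inT[s0 sT] /inT[t0 tT]; case: (ltgtP s t) => // st _.
  by rewrite gtr0_norm ?subr_gt0// X_holder_lt.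
by rewrite incrN normrN ltr0_norm ?subr_lt0// opprB X_holder_lt.
Qed.

Let B_norm_le (s t : R) : s \in `[0, T] -> t \in `[0, T] -> s != t ->
  `|incr B s t| <= rho * `|t - s| `^ al.
Proof.
move=> /inT[s0 sT] /inT[t0 tT]; case: (ltgtP s t) => // st _.
  by rewrite gtr0_norm ?subr_gt0// B_le.
by rewrite incrN normrN ltr0_norm ?subr_lt0// opprB B_le.
Qed.

(** For t < s, RX_{s,t} + RX_{t,s} = eps (sigma(X_t) - sigma(X_s)) B_{s,t}. *)
Lemma RX_holder (s t : R) : s \in `[0, T] -> t \in `[0, T] -> s != t ->
  `|RX s t| <= remainder_const * n%:R ^+ 2 * `|t - s| `^ (2 * al).
Proof.
move=> sT tT st; have [s0 sT'] := inT sT; have [t0 tT'] := inT tT.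
have C0 : 0 <= W * holder_const * inv_scale.
  by rewrite !mulr_ge0 ?holder_const_ge0.
case: (ltgtP s t) (st) => // st' _.
  rewrite gtr0_norm ?subr_gt0//; apply: le_trans (RX_holder_lt s0 st' tT') _.
  by rewrite ler_wpM2r ?powR_ge0// ler_wpM2r ?exprn_ge0// lerBlDr lerDl.
have -> : RX s t = - RX t s + eps *: ((sigma (X t) - sigma (X s)) *m incr B s t).
  rewrite /RX /remainder (lapp_mulmx (sigma (X s)) eps) (lapp_mulmx (sigma (X t)) eps).
  rewrite mulmxBl (incrN B s t) !mulmxN /incr; move: (_ *m _) (_ *m _) => v1 v2.
  by apply/matrixP => i j; rewrite !mxE; ring.
apply: le_trans (ler_normD _ _) _; rewrite normrN normrZ.
have E1 := RX_holder_lt t0 st' sT'.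
have E2 : `|eps| * `|(sigma (X t) - sigma (X s)) *m incr B s t| <=
   W * holder_const * inv_scale * n%:R ^+ 2 * `|t - s| `^ (2 * al).
  apply: le_trans (ler_piMl _ _) _ => //.
    by case/andP: eps01 => e0 e1; rewrite gtr0_norm.
  apply: le_trans (mx_norm_mulmx _ _) _.
  have S := sigma_lipschitz sigmaM (X s) (X t).
  have XX := X_holder sT tT st.
  have BB' := B_norm_le sT tT st.
  have h0 : 0 <= `|t - s| `^ al by exact: powR_ge0.
  rewrite powR2M; move: (`|t - s| `^ al) h0 XX BB' => h h0 XX BB'.
  have {}S : `|sigma (X t) - sigma (X s)| <= M * (holder_const * n%:R * h).
    by apply: le_trans S _; rewrite ler_wpM2l.
  have {}BB' : `|incr B s t| <= inv_scale * n%:R * h.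
    by apply: le_trans BB' _; rewrite ler_wpM2r.
  apply: le_trans (ler_wpM2l (ler0n _ _) (ler_pM _ _ S BB')) _ => //.
  by rewrite le_eqVlt; apply/orP; left; apply/eqP; rewrite /W; ring.
apply: le_trans (lerD E1 E2) _.
by rewrite ltr0_norm ?subr_lt0// opprB -!mulrDl subrK.
Qed.

Lemma Rsigma_holder (s t : R) : s \in `[0, T] -> t \in `[0, T] -> s != t ->
  `|Rsigma s t| <= sigma_remainder_const * n%:R ^+ 2 * `|t - s| `^ (2 * al).
Proof.
move=> sT tT st.
apply: le_trans (remainder_sigma_norm_le sigmaM eps X B s t) _.
have E1 := RX_holder sT tT st.
have E2 : `|G s t| <= W * (inv_scale * n%:R) * `|t - s| `^ al.
  apply: le_trans (lapp_norm_le (c := M) _ _) _ => [i|].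
    exact: (gubX_norm_le sigmaM).
  rewrite /W -2!(mulrA r%:R) -(mulrA M) ler_wpM2l// ler_wpM2l//.
  by apply: le_trans (B_norm_le sT tT st) _; rewrite ler_wpM2r ?powR_ge0.
have {}E2 : `|G s t| ^+ 2 <= (W * (inv_scale * n%:R) * `|t - s| `^ al) ^+ 2.
  by rewrite lerXn2r ?nnegrE// !mulr_ge0 ?powR_ge0.
apply: le_trans (lerD (ler_wpM2l M0 E1) (ler_wpM2l M0 E2)) _.
rewrite powR2M le_eqVlt; apply/orP; left; apply/eqP.
by rewrite /sigma_remainder_const; ring.
Qed.

End RoughDifferentialEquation.

(** * The number of steps *)

Section Mesh.
Variable R : realType.

Definition mesh_const (T K al e : R) : R := T * e^-1 `^ al^-1 + 4 * K * T + 1.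

(** Take the first integer n above T (rho / e)^(1/al) + 4 K T: the first summand
    makes rho (T / n)^al small, the second one 4 K T / n. *)
Lemma mesh_exists (T K al e rho : R) : 0 < T -> 0 < K -> 0 < al -> 0 < e ->
  0 <= rho -> exists n : nat, [/\ (0 < n)%N, rho * (T / n%:R) `^ al <= e,
    4 * K * (T / n%:R) <= 1 &
    n%:R <= mesh_const T K al e * (1 + rho `^ al^-1)].
Proof.
move=> T0 K0 al0 e0 rho0.
pose p := rho / e.
have p0 : 0 <= p by rewrite divr_ge0// ltW.
have pw0 : 0 <= p `^ al^-1 by exact: powR_ge0.
have KT0 : 0 < 4 * K * T by rewrite !mulr_gt0.
pose x := T * p `^ al^-1 + 4 * K * T.
have x0 : 0 <= x by rewrite addr_ge0// ?mulr_ge0// ltW.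
exists (Num.truncn x).+1.
set n := (Num.truncn x).+1.
have n0 : 0 < n%:R :> R by rewrite ltr0n.
have xn : x <= n%:R by rewrite ltW// truncnS_gt.
split=> //.
- have pn : p <= (n%:R / T) `^ al.
    have -> : p = (p `^ al^-1) `^ al.
      by rewrite -powRrM mulVf ?gt_eqF// powRr1.
    apply: ge0_ler_powR; rewrite ?nnegrE ?divr_ge0// ?(ltW al0) ?(ltW n0) ?(ltW T0)//.
    rewrite ler_pdivlMr// mulrC (le_trans _ xn)// /x lerDl ltW//.
  rewrite -(invf_div n%:R T) -powR_inv1 ?divr_ge0 ?(ltW n0) ?(ltW T0)//.
  rewrite powRAC powR_inv1 ?powR_ge0// ler_pdivrMr ?powR_gt0 ?divr_gt0//.
  by rewrite mulrC -ler_pdivrMr.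
- by rewrite mulrA ler_pdivrMr// mul1r (le_trans _ xn)// /x lerDr mulr_ge0// ltW.
- have nx : n%:R <= x + 1 by rewrite /n -natr1 lerD2r truncn_le.
  apply: le_trans nx _; rewrite /x /p powRM ?invr_ge0 ?(ltW e0)//.
  rewrite /mesh_const; set a := rho `^ _; set c := _^-1 `^ _.
  have a0 : 0 <= a by exact: powR_ge0.
  have c0 : 0 <= c by exact: powR_ge0.
  have t1 : 0 <= T * c by rewrite mulr_ge0// ltW.
  have t2 : 0 <= 4 * K * T * a by rewrite mulr_ge0// ltW.
  by lra.
Qed.

End Mesh.

(** * Extended Hoelder norms *)

Section HolderNorm.
Variables (R : realType) (V : normedModType R) (T : R).

Lemma hnorm2_le (a c : R) (Y : R -> R -> V) :
  (forall s t, s \in `[0, T] -> t \in `[0, T] -> s != t ->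
     `|Y s t| <= c * `|t - s| `^ a) -> (hnorm2 T a Y <= c%:E)%E.
Proof.
move=> Yc; apply: ge_ereal_sup => _ [s [t [sT tT st ->]]].
rewrite lee_fin ler_pdivrMr ?Yc//.
by rewrite powR_gt0// normr_gt0 subr_eq0 eq_sym.
Qed.

Lemma hnorm2_fin (a : R) (Y : R -> R -> V) : 0 < T -> (hnorm2 T a Y < +oo)%E ->
  exists c, [/\ 0 <= c, hnorm2 T a Y = c%:E &
    forall s t, s \in `[0, T] -> t \in `[0, T] -> s != t ->
     `|Y s t| <= c * `|t - s| `^ a].
Proof.
move=> T0 Yfin.
have ub s t : s \in `[0, T] -> t \in `[0, T] -> s != t ->
    ((`|Y s t| / `|t - s| `^ a)%:E <= hnorm2 T a Y)%E.
  by move=> sT tT st; apply: ereal_sup_ubound; exists s, t.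
have Y0 : (0 <= hnorm2 T a Y)%E.
  have ub0 : ((`|Y 0 T| / `|T - 0| `^ a)%:E <= hnorm2 T a Y)%E.
    by apply: ub; rewrite ?in_itv/= ?lexx ?(ltW T0)// lt_eqF.
  by apply: le_trans ub0; rewrite lee_fin divr_ge0// powR_ge0.
have Ynum : hnorm2 T a Y \is a fin_num by rewrite ge0_fin_numE.
exists (fine (hnorm2 T a Y)); split; first exact: fine_ge0.
  by rewrite fineK.
move=> s t sT tT st; rewrite -ler_pdivrMr.
  by rewrite -lee_fin fineK// ub.
by rewrite powR_gt0// normr_gt0 subr_eq0 eq_sym.
Qed.

Lemma holder_within_continuous (X : R -> V) (W : normedModType R)
    (g : V -> W) (a c k : R) : 0 < a -> 0 <= c -> 0 <= k ->
  (forall s t, s \in `[0, T] -> t \in `[0, T] -> s != t ->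
     `|X t - X s| <= c * `|t - s| `^ a) ->
  (forall x y, `|g y - g x| <= k * `|y - x|) ->
  {within `[0, T], continuous (g \o X)}.
Proof.
move=> a0 c0 k0 Xc gk; apply/subspace_continuousP => s /= sT.
apply/cvgrPdist_lt => e e0.
pose dl := (e / (k * c + 1)) `^ a^-1.
have kc : 0 < k * c + 1 by rewrite ltr_wpDl// mulr_ge0.
have dl0 : 0 < dl by rewrite powR_gt0// divr_gt0.
near=> t.
have tT : t \in `[0, T] by near: t; exact: withinT.
have [->|st] := eqVneq s t; first by rewrite subrr normr0.
have std : `|t - s| < dl.
  near: t; apply: cvg_within; apply/nbhs_ballP; exists dl => //= t.
  by rewrite /ball/= distrC.
rewrite distrC; apply: le_lt_trans (gk _ _) _.
apply: le_lt_trans (ler_wpM2l k0 (Xc _ _ sT tT st)) _.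
have pe : `|t - s| `^ a < e / (k * c + 1).
  have -> : e / (k * c + 1) = dl `^ a.
    by rewrite /dl -powRrM mulVf ?gt_eqF// powRr1// divr_ge0 ?ltW.
  by rewrite gt0_ltr_powR ?nnegrE// ltW.
rewrite ltr_pdivlMr// in pe; apply: le_lt_trans pe.
by rewrite mulrA mulrC ler_wpM2l ?powR_ge0// lerDl.
Unshelve. all: by end_near. Qed.

End HolderNorm.

(** * The bounds along one rough path *)

(** The only partition of [0, 0] is empty, so the rough integral vanishes there. *)
Lemma rde_solution_start (R : realType) (d r : nat) (T a : R) (x0 : 'cV[R]_d)
    (f : 'cV[R]_d -> 'cV[R]_d) (sigma : 'cV[R]_d -> 'M[R]_(d, r)) (eps : R)
    (B : R -> 'cV[R]_r) (BB : R -> R -> 'M[R]_r) (X : R -> 'cV[R]_d) :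
  0 <= T -> rde_solution T a x0 f sigma eps B BB X -> X 0 = x0.
Proof.
move=> T0 [_ sol]; have [|I hI ->] := sol 0; first by rewrite in_itv /= lexx.
have -> : I = 0.
  apply/eqP; rewrite -normr_le0; apply/ler_addgt0Pr => e e0; rewrite add0r.
  have /cvgrPdist_lt/(_ _ e0)[dl dl0 /(_ [::])] := hI.
  rewrite mesh_nil => /(_ _ dl0) /=.
  rewrite /partition_sum big_geq// subr0 => H; apply/ltW/H.
  by split => //=.
rewrite scaler0 addr0; apply/matrixP => i j; rewrite !mxE.
by rewrite set_itv1 Rintegral_set1 addr0.
Qed.

(** The constants are chosen before f: of the drift they see only its linear growth
    K. Lipschitz continuity of f makes f(X) continuous in time, hence integrable. *)
Theorem rde_pathwise_bounds (R : realType) (d r : nat) (T : R) (x0 : 'cV[R]_d)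
    (sigma : 'cV[R]_d -> 'M[R]_(d, r)) (K al : R) :
  (0 < r)%N -> 0 < T -> 0 < K -> Cb 3 sigma -> 3^-1 < al -> al < 2^-1 ->
  exists C1 C2 C3 : R, [/\ 0 < C1, 0 < C2 & 0 < C3] /\
  forall (f : 'cV[R]_d -> 'cV[R]_d) (c : R) (eps : R)
    (B : R -> 'cV[R]_r) (BB : R -> R -> 'M[R]_r) (X : R -> 'cV[R]_d),
  0 <= c -> (forall x y, `|f y - f x| <= c * `|y - x|) ->
  (forall x, `|f x| <= K * (1 + `|x|)) ->
  0 < eps <= 1 -> geometric_rough_path T al B BB ->
  rde_solution T al x0 f sigma eps B BB X ->
  let rho := rp_norm T al B BB in
  [/\ (hnorm T al X <= C1%:E * (1 + rho `^ al^-1))%E,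
      (hnorm2 T (2 * al)%R (remainder B X (gubX sigma eps X))
         <= C2%:E * (1 + rho `^ (2 / al)%R))%E
    & (hnorm2 T (2 * al)%R (remainder B (sigma \o X) (gubS sigma eps X))
         <= C3%:E * (1 + rho `^ (2 / al)%R))%E].
Proof.
move=> r0 T0 K0 /Cb_C2_bounded[M sigmaM].
move=> al13 al12; have al0 : 0 < al by apply: lt_trans al13; rewrite invr_gt0.
have e0 := small_scale_gt0 r0 sigmaM al13.
pose N := mesh_const T K al (small_scale r M al).
pose c1 := holder_const r M T al x0 K.
pose c2 := remainder_const r M T al x0 K.
pose c3 := sigma_remainder_const r M T al x0 K.
have c10 : 0 <= c1 by exact: (holder_const_ge0 r0 sigmaM).
have c20 : 0 <= c2 by exact: (remainder_const_ge0 r0 sigmaM).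
have c30 : 0 <= c3 by exact: (sigma_remainder_const_ge0 r0 sigmaM).
have N0 : 0 <= N.
  by rewrite !addr_ge0// ?mulr_ge0 ?powR_ge0// ?mulr_ge0 ?(ltW T0) ?(ltW K0).
exists (c1 * N + 1), (c2 * (2 * N ^+ 2) + 1), (c3 * (2 * N ^+ 2) + 1).
have N20 : 0 <= 2 * N ^+ 2 by rewrite mulr_ge0// exprn_ge0.
split; first by split; rewrite ltr_wpDl// mulr_ge0.
move=> f c eps B BB X c0 flip flin eps01 [Bfin BBfin chen _] sol rho.
have X0 := rde_solution_start (ltW T0) sol.
case: sol => -[Xfin _ Rfin] sol.
have in0T (s : R) : 0 <= s -> s <= T -> s \in `[0, T].
  by move=> s0 sT; rewrite in_itv/= s0.
have [a [a0 aE aB]] := hnorm2_fin T0 Bfin.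
have [b [b0 bE bBB]] := hnorm2_fin T0 BBfin.
have [cX [cX0 _ XcX]] := hnorm2_fin T0 Xfin.
have [cR [cR0 _ RcR]] := hnorm2_fin T0 Rfin.
pose p := a + b `^ 2^-1.
have sb0 : 0 <= b `^ 2^-1 by exact: powR_ge0.
have p0 : 0 <= p by rewrite addr_ge0.
have rhoE : rho = p%:E.
  by rewrite /rho /rp_norm /hnorm aE bE poweR_EFin.
have ap : a <= p by rewrite lerDl.
have bp : b <= p ^+ 2.
  have -> : b = (b `^ 2^-1) ^+ 2.
    by rewrite -powR_mulrn// -powRrM mulVf// powRr1.
  by rewrite lerXn2r ?nnegrE// lerDr.
have [n [n0 small Ksmall nN]] := mesh_exists T0 K0 al0 e0 p0.
have B_le (s t : R) : 0 <= s -> s < t -> t <= T ->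
    `|incr B s t| <= p * (t - s) `^ al.
  move=> s0 st tT; have := aB s t; rewrite gtr0_norm ?subr_gt0// => H.
  apply: le_trans (H _ _ _) _; rewrite ?lt_eqF ?ler_wpM2r ?powR_ge0//.
    by apply: in0T => //; rewrite (le_trans (ltW st)).
  by apply: in0T => //; rewrite (le_trans s0)// ltW.
have BB_le (s t : R) : 0 <= s -> s < t -> t <= T ->
    `|BB s t| <= p ^+ 2 * (t - s) `^ (2 * al).
  move=> s0 st tT; have := bBB s t; rewrite gtr0_norm ?subr_gt0// => H.
  apply: le_trans (H _ _ _) _; rewrite ?lt_eqF ?ler_wpM2r ?powR_ge0//.
    by apply: in0T => //; rewrite (le_trans (ltW st)).
  by apply: in0T => //; rewrite (le_trans s0)// ltW.
have chen_lt (s u t : R) : 0 <= s -> s < u -> u < t -> t <= T ->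
    BB s t = BB s u + BB u t + incr B s u *m (incr B u t)^T.
  move=> s0 su ut tT.
  by apply: chen; apply: in0T => //; lra.
have {}sol (t : R) : exists I : 'cV[R]_d, t \in `[0, T] ->
    partition_sum 0 t (germ B BB (sigma \o X) (gubS sigma eps X)) l
      @[l --> mesh_to0 0 t] --> I /\
    X t = x0 + drift (f \o X) t + eps *: I.
  have [tT|tT] := boolP (t \in `[0, T]); last by exists 0.
  by have [I hI XI] := sol t tT; exists I.
have [I hI] := choice sol.
have I_lim (u : R) : u \in `[0, T] ->
    partition_sum 0 u (germ B BB (sigma \o X) (gubS sigma eps X)) l
      @[l --> mesh_to0 0 u] --> I u by move=> /hI[].
have X_eq (t : R) : 0 <= t -> t <= T -> X t = x0 + drift (f \o X) t + eps *: I t.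
  by move=> t0 tT; have [] := hI t (in0T t t0 tT).
have drift_le (s t L : R) : 0 <= s -> s <= t -> t <= T -> 0 <= L ->
    (forall u : R, s <= u <= t -> `|f (X u)| <= L) ->
    `|drift (f \o X) t - drift (f \o X) s| <= L * (t - s).
  move=> s0 st tT L0 fL; apply: (@drift_incr_le _ _ _ T) => // k.
  apply: (@holder_within_continuous _ _ T X R^o (fun x => f x k 0) al cX c) => //.
  move=> x y; apply: le_trans (flip x y).
  by have := mx_norm_entry (f y - f x) k 0; rewrite !mxE.
have RX_fin : exists y : R, forall s t : R, 0 <= s -> s < t -> t <= T ->
    `|remainder B X (gubX sigma eps X) s t| <= y * (t - s) `^ (2 * al).
  exists cR => s t s0 st tT; have := RcR s t; rewrite gtr0_norm ?subr_gt0//.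
  by apply; rewrite ?lt_eqF//; apply: in0T => //; lra.
have X_fin : exists y : R, forall t : R, 0 <= t -> t <= T -> `|X t| <= y.
  exists (`|x0| + cX * T `^ al) => t t0 tT.
  have [->|tn0] := eqVneq t 0.
    by rewrite X0 lerDl mulr_ge0// powR_ge0.
  have -> : X t = x0 + incr X 0 t by rewrite /incr X0 addrC subrK.
  rewrite (le_trans (ler_normD _ _))// lerD2l.
  have n0t : 0 != t by rewrite eq_sym.
  apply: le_trans (XcX 0 t (in0T _ (lexx _) (ltW T0)) (in0T _ t0 tT) n0t) _.
  rewrite subr0 ger0_norm// ler_wpM2l//.
  by apply: ge0_ler_powR; rewrite ?nnegrE ?(ltW al0) ?(ltW T0).
have XH := X_holder r0 sigmaM al13 al12 p0 B_le BB_le chen_lt eps01 I_lim X_eq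
  drift_le RX_fin K0 T0 flin X0 X_fin
  n0 small Ksmall.
have RH := RX_holder r0 sigmaM al13 al12 p0 B_le BB_le chen_lt eps01 I_lim X_eq
  drift_le RX_fin K0 T0 flin X0 X_fin
  n0 small Ksmall.
have SH := Rsigma_holder r0 sigmaM al13 al12 p0 B_le BB_le chen_lt eps01 I_lim X_eq
  drift_le RX_fin K0 T0 flin X0 X_fin
  n0 small Ksmall.
rewrite rhoE !poweR_EFin.
have pw0 : 0 <= p `^ al^-1 by exact: powR_ge0.
have pw20 : 0 <= p `^ (2 / al) by exact: powR_ge0.
have n2N : n%:R ^+ 2 <= 2 * N ^+ 2 * (1 + p `^ (2 / al)).
  rewrite powR2M; set q := p `^ _ in nN pw0 *.
  apply: (@le_trans _ _ ((N * (1 + q)) ^+ 2)).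
    by rewrite lerXn2r ?nnegrE// mulr_ge0// addr_ge0.
  rewrite (_ : 2 * N ^+ 2 * _ = N ^+ 2 * (2 * (1 + q ^+ 2))); last by ring.
  rewrite exprMn ler_wpM2l ?exprn_ge0//.
  have : 0 <= (1 - q) ^+ 2 by rewrite sqr_ge0.
  rewrite !expr2; lra.
have scaled (k y z w : R) : 0 <= k -> 0 <= z -> y <= w * (1 + z) ->
    ((k * y)%:E <= (k * w + 1)%:E * (1 + z%:E))%E.
  move=> k0 z0 yw; rewrite -EFinD -EFinM lee_fin.
  have H := ler_wpM2l k0 yw.
  by rewrite mulrDl mul1r -mulrA (le_trans H)// lerDl addr_ge0.
split.
- exact: le_trans (hnorm2_le XH) (scaled _ _ _ _ c10 pw0 nN).
- exact: le_trans (hnorm2_le RH) (scaled _ _ _ _ c20 pw20 n2N).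
- exact: le_trans (hnorm2_le SH) (scaled _ _ _ _ c30 pw20 n2N).
Qed.

Theorem lemma2 (R : realType) (d m r : nat) (T : R) (X0 : 'cV[R]_d)
    (Theta : set 'cV[R]_m) (q : R)
    (b : 'cV[R]_d -> 'cV[R]_m -> 'cV[R]_d)
    (sigma : 'cV[R]_d -> 'M[R]_(d, r)) :
  (0 < r)%N -> 0 < T ->
  open Theta -> bounded_set Theta -> convex_set Theta ->
  m%:R < q -> sobolev_embedding Theta q ->
  Cmixed 1 4 Theta b ->
  (exists c1 c2 N : R,
    [/\ 0 < c1, 0 < c2, 0 < N,
        forall x y theta, Theta theta ->
          `|b x theta - b y theta| <= c1 * `|x - y|
      & forall us vs, unit_dirs 1 us -> unit_dirs 4 vs ->
          forall x theta, Theta theta ->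
          `|mixed_derive us vs b x theta| <= c2 * (1 + `|x| `^ N)]) ->
  Cb 3 sigma ->
  forall alpha : R, 3^-1 < alpha ->
  exists C1 C2 C3 : R, [/\ 0 < C1, 0 < C2 & 0 < C3] /\
  forall (theta0 : 'cV[R]_m) (H : 'I_r -> R) (h : R)
    (disp : measure_display) (Omega : measurableType disp)
    (P : probability Omega R)
    (B : 'I_r -> R -> {RV P >-> R})
    (BB : 'I_r -> 'I_r -> R -> R -> {RV P >-> R}),
  Theta theta0 ->
  (forall i, 3^-1 < H i < 2^-1) -> (forall i, h < H i) -> alpha < h ->
  (forall i, is_fbm T (H i) (B i)) -> independent_processes T B ->
  is_lift T alpha B BB ->
  forall (eps : R) (X : Omega -> R -> 'cV[R]_d),
  0 < eps <= 1 ->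
  {ae P, forall w, rde_solution T alpha X0 (b ^~ theta0) sigma eps
                     (path_of B w) (area_of BB w) (X w)} ->
  {ae P, forall w,
    let rho := rp_norm T alpha (path_of B w) (area_of BB w) in
    [/\ (hnorm T alpha (X w) <= C1%:E * (1 + rho `^ alpha^-1))%E,
        (hnorm2 T (2 * alpha)%R
           (remainder (path_of B w) (X w) (gubX sigma eps (X w)))
         <= C2%:E * (1 + rho `^ (2 / alpha)%R))%E
      & (hnorm2 T (2 * alpha)%R
           (remainder (path_of B w) (sigma \o X w) (gubS sigma eps (X w)))
         <= C3%:E * (1 + rho `^ (2 / alpha)%R))%E]}.
Proof.
move=> r0 T0 _ _ _ _ _ _ [c1 [c2 [N [c10 c20 N0 b_lip b_le]]]] Cb_sigma alpha al13.
have [al12|al12] := ltP alpha 2^-1; last first.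
  (* alpha < h < H_i < 1/2 is then impossible *)
  exists 1, 1, 1; split; first by split.
  move=> theta0 H h disp Omega P B BB _ H12 hH alh; exfalso.
  have /andP[_ H_lt] := H12 (Ordinal r0).
  have := lt_trans alh (lt_trans (hH (Ordinal r0)) H_lt).
  by rewrite ltNge al12.
have K0 : 0 < c1 + c2 by rewrite addr_gt0.
have [C1 [C2 [C3 [C0 bound]]]] := rde_pathwise_bounds X0 r0 T0 K0 Cb_sigma al13 al12.
exists C1, C2, C3; split=> //.
move=> theta0 H h disp Omega P B BB theta0P _ _ _ _ _ [_ _ _ geo] eps X eps01 sol.
apply: filterS2 geo sol => w geo sol; apply: bound (ltW c10) _ _ eps01 geo sol.
  by move=> x y; exact: b_lip.
move=> x /=; have b0 : `|b 0 theta0| <= c2.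
  have := b_le [::] [::] _ _ 0 theta0 theta0P.
  rewrite normr0 powR0 ?gt_eqF// addr0 mulr1; apply.
    by split.
  by split.
have -> : b x theta0 = b 0 theta0 + (b x theta0 - b 0 theta0) by rewrite addrC subrK.
apply: le_trans (ler_normD _ _) _.
have := b_lip x 0 theta0 theta0P; rewrite subr0 => bx.
have x0 : 0 <= c2 * `|x| by rewrite mulr_ge0// ltW.
by apply: le_trans (lerD b0 bx) _; lra.
Qed.
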